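(* The following cubic forms $f\in\mathbb{C}[x_1,x_2,x_3,x_4]$ (normal forms of cubic surfaces with the indicated singularity type) have the following ranks. 1. ($A_1$) $f = x_4(x_2^2-x_1x_3) + x_2x_1^2-(1+\rho_1+\rho_2+\rho_3)x_1x_2^2 + (\rho_1+\rho_2\rho_3)x_1x_2x_3 +(1+\rho_1)(\rho_2+\rho_3)x_2^3 - ((1+\rho_1)\rho_2\rho_3+\rho_1(\rho_2+\rho_3))x_2^2x_3 + \rho_1\rho_2\rho_3x_2x_3^2$, with $\rho_1,\rho_2,\rho_3\in \mathbb{C}\setminus\{0,1\}$ pairwise different: rank $5$ for generic $(\rho_1,\rho_2,\rho_3)$, for example for $(-1,2,-2)$. 2. ($2A_1$) $f = x_4(x_2^2-x_1x_3) + x_2(x_1-(1+\rho_1)x_2+\rho_1x_3)(x_1-\rho_2x_2)$, with $\rho_1\neq\rho_2$ in $\mathbb{C}\setminus\{0,1\}$: rank $5$ for generic $(\rho_1,\rho_2)$, for example for $(-1,2)$. 3. ($3A_1$) $f = x_4(x_2^2-x_1x_3) + x_2^2(x_1-(1+\rho)x_2+\rho x_3)$, with $\rho\in\mathbb{C}\setminus\{0,1\}$: rank $5$ if $\rho^2\neq\frac{14}{9}\rho-1$. 4. ($4A_1$) $f = x_4(x_2^2-x_1x_3)+x_2^2(x_1-2x_2+x_3)$: rank $5$. 5. ($A_1A_2$) $f = x_4(x_2^2-x_1x_3)+x_1x_2(x_1-(1+\rho)x_2+\rho x_3)$, with $\rho\in\mathbb{C}\setminus\{0,1\}$: rank $6$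 if $\rho=\frac12(1\pm\sqrt{3}\,i)$. 6. ($2A_1A_2$) $f = x_4(x_2^2-x_1x_3)+x_2^2(x_1-x_2)$: rank $6$. 7. ($A_12A_2$) $f = x_4(x_2^2-x_1x_3)+x_2^3$: rank $6$. 8. ($A_1A_3$) $f = x_4(x_2^2-x_1x_3)+x_1^2x_2-x_1x_2^2$: rank $6$. 9. ($2A_1A_3$) $f = x_4(x_2^2-x_1x_3)+x_1x_2^2$: rank $6$. 10. ($A_1A_4$) $f = x_4(x_2^2-x_1x_3)+x_1^2x_2$: rank $6$. 11. ($A_1A_5$) $f = x_4(x_2^2-x_1x_3)+x_1^3$: rank $6$. 12. ($A_2$) $f = x_4x_1x_2-x_3(x_1^2+x_2^2+x_3^2+\rho_1 x_1x_3+\rho_2x_2x_3)$, with $\rho_1,\rho_2\in\mathbb{C}\setminus\{\pm2\}$: rank $6$ if $\rho_1=\rho_2=0$. 13. ($2A_2$) $f = x_4x_1x_2-x_3(x_1^2+x_3^2+\rho x_1x_3)$, with $\rho\in\mathbb{C}\setminus\{\pm2\}$: rank $6$ if $\rho^2\neq3$. 14. ($3A_2$) $f = x_4x_1x_2-x_3^3$: rank $5$. 15. ($A_3$) $f = x_4x_1x_2+x_1(x_1^2-x_3^2)+\rho x_2(x_2^2-x_3^2)$, with $\rho\neq0$: rank $6$. 16. ($A_4$) $f = x_4x_1x_2+x_1^2x_3+x_2(x_2^2-x_3^2)$: rank $6$. 17. ($A_5$) $f = x_4x_1x_2+x_1^3+x_2(x_2^2-x_3^2)$: rank $6$. 18.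 ($D_4^{I}$) $f = x_4x_1^2+x_2^3+x_3^3+x_1x_2x_3$: rank $6$. 19. ($D_4^{II}$) $f = x_4x_1^2+x_2^3+x_3^3$: rank $5$. 20. ($D_5$) $f = x_4x_1^2+x_1x_3^2+x_2^2x_3$: rank $6$. 21. ($E_6$) $f = x_4x_1^2+x_1x_3^2+x_2^3$: rank $6$. 22. ($\tilde{E_6}$) $f = x_1^3+x_2^3+x_3^3-3\rho x_1x_2x_3$, with $\rho^3\neq1$: rank $3$ if $\rho^3=0$ or $\rho^3=-8$, and rank $4$ otherwise.
   Context: The rank of a nonzero homogeneous polynomial $f$ of degree $d$ with complex coefficients is the smallest $r$ such that $f=l_1^d+\cdots+l_r^d$ with $l_1,\ldots,l_r$ linear forms with complex coefficients. ''For generic parameters'' means for all admissible parameters outside a proper Zariski closed subset of the parameter space. The labels $A_k, D_k, E_6,\tilde E_6$ name the singularity type of the surface $\{f=0\}\subset\mathbb{P}^3$ (for example $2A_1A_2$ means two $A_1$ singularities and one $A_2$ singularity); they serve only to identify the normal form, and the claim concerns the ranks of the displayed forms. *)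

(* Defs.v *)
From HB Require Import structures.
From mathcomp Require Import all_boot all_order all_algebra.
From mathcomp Require Import reals.
From mathcomp Require Import complex.
From mathcomp Require Import mpoly.

Set Implicit Arguments.
Unset Strict Implicit.
Unset Printing Implicit Defensive.

Import Order.TTheory GRing.Theory Num.Theory.

Local Open Scope ring_scope.

Section Rank.
Variables (K : comNzRingType) (n : nat).

Definition sum_of_powers (d r : nat) (f : {mpoly K[n]}) : Prop :=
  exists l : 'I_r -> {mpoly K[n]},
    (forall i, l i \is 1%N.-homog) /\ f = \sum_(i < r) l i ^+ d.

(* [d] is the degree of [f]; for [r > 0] this forces [f] to be nonzero and
   homogeneous of degree [d]. *)
Definition has_rank (d : nat) (f : {mpoly K[n]}) (r : nat) : Prop :=
  sum_of_powers d r f /\ (forall s, sum_of_powers d s f -> (r <= s)%N).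

End Rank.

Section Generic.
Variables (K : comNzRingType) (n : nat).

Definition zariski_closed (Z : ('I_n -> K) -> Prop) : Prop :=
  exists S : {mpoly K[n]} -> Prop,
    forall v, Z v <-> (forall p, S p -> p.@[v] = 0).

(* [P] holds at every point of the parameter space [U] outside a closed set
   that does not contain [U]. *)
Definition generically (U P : ('I_n -> K) -> Prop) : Prop :=
  exists Z, [/\ zariski_closed Z, exists v, U v /\ ~ Z v
              & forall v, U v -> ~ Z v -> P v].

End Generic.

Section NormalForms.
Variable K : comNzRingType.

Notation x1 := ('X_(0 : 'I_4) : {mpoly K[4]}).
Notation x2 := ('X_(1 : 'I_4) : {mpoly K[4]}).
Notation x3 := ('X_(2 : 'I_4) : {mpoly K[4]}).
Notation x4 := ('X_(3 : 'I_4) : {mpoly K[4]}).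

Implicit Types rho : K.

Definition form_A1 rho1 rho2 rho3 : {mpoly K[4]} :=
  x4 * (x2 ^+ 2 - x1 * x3) + x2 * x1 ^+ 2
  - (1 + rho1 + rho2 + rho3) *: (x1 * x2 ^+ 2)
  + (rho1 + rho2 * rho3) *: (x1 * x2 * x3)
  + ((1 + rho1) * (rho2 + rho3)) *: x2 ^+ 3
  - ((1 + rho1) * rho2 * rho3 + rho1 * (rho2 + rho3)) *: (x2 ^+ 2 * x3)
  + (rho1 * rho2 * rho3) *: (x2 * x3 ^+ 2).

Definition form_2A1 rho1 rho2 : {mpoly K[4]} :=
  x4 * (x2 ^+ 2 - x1 * x3)
  + x2 * (x1 - (1 + rho1) *: x2 + rho1 *: x3) * (x1 - rho2 *: x2).

Definition form_3A1 rho : {mpoly K[4]} :=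
  x4 * (x2 ^+ 2 - x1 * x3) + x2 ^+ 2 * (x1 - (1 + rho) *: x2 + rho *: x3).

Definition form_4A1 : {mpoly K[4]} :=
  x4 * (x2 ^+ 2 - x1 * x3) + x2 ^+ 2 * (x1 - 2 * x2 + x3).

Definition form_A1A2 rho : {mpoly K[4]} :=
  x4 * (x2 ^+ 2 - x1 * x3) + x1 * x2 * (x1 - (1 + rho) *: x2 + rho *: x3).

Definition form_2A1A2 : {mpoly K[4]} :=
  x4 * (x2 ^+ 2 - x1 * x3) + x2 ^+ 2 * (x1 - x2).

Definition form_A1_2A2 : {mpoly K[4]} :=
  x4 * (x2 ^+ 2 - x1 * x3) + x2 ^+ 3.

Definition form_A1A3 : {mpoly K[4]} :=
  x4 * (x2 ^+ 2 - x1 * x3) + x1 ^+ 2 * x2 - x1 * x2 ^+ 2.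

Definition form_2A1A3 : {mpoly K[4]} :=
  x4 * (x2 ^+ 2 - x1 * x3) + x1 * x2 ^+ 2.

Definition form_A1A4 : {mpoly K[4]} :=
  x4 * (x2 ^+ 2 - x1 * x3) + x1 ^+ 2 * x2.

Definition form_A1A5 : {mpoly K[4]} :=
  x4 * (x2 ^+ 2 - x1 * x3) + x1 ^+ 3.

Definition form_A2 rho1 rho2 : {mpoly K[4]} :=
  x4 * x1 * x2
  - x3 * (x1 ^+ 2 + x2 ^+ 2 + x3 ^+ 2 + rho1 *: (x1 * x3) + rho2 *: (x2 * x3)).

Definition form_2A2 rho : {mpoly K[4]} :=
  x4 * x1 * x2 - x3 * (x1 ^+ 2 + x3 ^+ 2 + rho *: (x1 * x3)).

Definition form_3A2 : {mpoly K[4]} :=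
  x4 * x1 * x2 - x3 ^+ 3.

Definition form_A3 rho : {mpoly K[4]} :=
  x4 * x1 * x2 + x1 * (x1 ^+ 2 - x3 ^+ 2) + rho *: (x2 * (x2 ^+ 2 - x3 ^+ 2)).

Definition form_A4 : {mpoly K[4]} :=
  x4 * x1 * x2 + x1 ^+ 2 * x3 + x2 * (x2 ^+ 2 - x3 ^+ 2).

Definition form_A5 : {mpoly K[4]} :=
  x4 * x1 * x2 + x1 ^+ 3 + x2 * (x2 ^+ 2 - x3 ^+ 2).

Definition form_D4_I : {mpoly K[4]} :=
  x4 * x1 ^+ 2 + x2 ^+ 3 + x3 ^+ 3 + x1 * x2 * x3.

Definition form_D4_II : {mpoly K[4]} :=
  x4 * x1 ^+ 2 + x2 ^+ 3 + x3 ^+ 3.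

Definition form_D5 : {mpoly K[4]} :=
  x4 * x1 ^+ 2 + x1 * x3 ^+ 2 + x2 ^+ 2 * x3.

Definition form_E6 : {mpoly K[4]} :=
  x4 * x1 ^+ 2 + x1 * x3 ^+ 2 + x2 ^+ 3.

Definition form_E6_tilde rho : {mpoly K[4]} :=
  x1 ^+ 3 + x2 ^+ 3 + x3 ^+ 3 - (3 * rho) *: (x1 * x2 * x3).

End NormalForms.

Arguments form_4A1 {K}.
Arguments form_2A1A2 {K}.
Arguments form_A1_2A2 {K}.
Arguments form_A1A3 {K}.
Arguments form_2A1A3 {K}.
Arguments form_A1A4 {K}.
Arguments form_A1A5 {K}.
Arguments form_3A2 {K}.
Arguments form_A4 {K}.
Arguments form_A5 {K}.
Arguments form_D4_I {K}.
Arguments form_D4_II {K}.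
Arguments form_D5 {K}.
Arguments form_E6 {K}.

(* Parameters in [K \ {0, 1}], pairwise different. *)
Definition admissible (K : comNzRingType) (n : nat) (v : 'I_n -> K) : Prop :=
  (forall i, v i != 0 /\ v i != 1) /\ injective v.

(* Main.v *)
Require Import Defs.
From mathcomp Require Import all_boot all_order all_algebra.
From mathcomp Require Import reals.
From mathcomp Require Import complex.
From mathcomp Require Import mpoly.
From mathcomp Require Import separable ring.

Import Order.TTheory GRing.Theory Num.Theory.
Local Open Scope ring_scope.
Set Implicit Arguments.
Unset Strict Implicit.
Unset Printing Implicit Defensive.

(** Each rank is obtained from a lower bound, read off a singular point of the
    surface, and an upper bound, given by a decomposition that is explicit up
    to the roots of a polynomial with distinct roots.

    Lower bounds.  Let [f] be a sum of the cubes of [r] linear forms [l_j] in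
    [n] variables, and assume that no polar quadric of [f] vanishes
    ([concise]).  Then the [l_j] span the dual space, so [r >= n].  If [p] is a
    singular point, the gradient [3 * sum_j l_j(p)^2 l_j] of [f] at [p] is zero,
    which is a nontrivial linear relation between the [l_j], so [r > n]
    ([singular_rank]).  If [r = n + 1], that relation is the only one up to
    scalars.  If, in addition, the Hessian of [f] at [p] kills a vector [v]
    outside the line of [p], then the relation [sum_j l_j(p) l_j(v) l_j = 0] is
    a multiple of the first one; so some [l_j] vanishes at [p] but not at [v],
    has coefficient zero in the relation, hence is independent of the other
    forms, and its square is a polar quadric of [f]
    ([degenerate_singular_rank]).  A form of rank 6 in the list has a singular
    point which is not an ordinary node, and its polar quadrics contain no such
    square.  A plane cubic [f] is treated through [f + x4^3].

    Upper bounds.  Sylvester's method expresses a finite sequence that satisfies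
    a linear recurrence with distinct characteristic roots as a combination of
    geometric progressions ([sylvester]).  Applied to the coefficients of the
    cube of a linear form that moves on a rational curve ([curve_cubes]), it
    writes a binary cubic with distinct roots as two cubes
    ([binary_cubic_cubes]).  A plane cubic that is nodal, or the union of a
    conic and a secant line, is a sum of four cubes ([nodal_cubes],
    [conic_secant_cubes]).  Most of the normal forms split as the sum of such
    a plane cubic and of a binary cubic.  For A4 and A1A4 the linear forms are
    taken on a twisted cubic instead ([twisted_cubic_cubes]).

    The form A1 is [x4 Q + C], with a smooth conic [Q = 0] on which [C] cuts out
    the sextic with roots infinity, 0, 1, rho1, rho2, rho3.  As one root of the
    sextic is known, there is a twisted cubic, rational in the parameters, that
    carries the five linear forms; they correspond to the roots of an explicit
    quintic ([node_cubes]), and the discriminant of this quintic is a polynomial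
    in the parameters outside the zero set of which the rank is 5.  The form 2A1
    is the specialization [rho3 = 0]. *)

(** * Polynomial identities checked pointwise *)

(** Digits in base [B] are unique: the exponents of a polynomial of partial
    degrees below [B] survive the Kronecker substitution [X_i := X^(B^i)]. *)
Lemma kronecker_inj n B (a b : 'I_n -> nat) :
  (forall i, a i < B)%N -> (forall i, b i < B)%N ->
  (\sum_(i < n) a i * B ^ i = \sum_(i < n) b i * B ^ i)%N -> a =1 b.
Proof.
elim: n a b => [|n IHn] a b ltaB ltbB; first by move=> _ [].
have split (c : 'I_n.+1 -> nat) : (\sum_(i < n.+1) c i * B ^ i =
    (\sum_(i < n) c (lift ord0 i) * B ^ i) * B + c ord0)%N.
  rewrite big_ord_recl muln1 addnC big_distrl; congr (_ + _)%N.
  by apply: eq_bigr => i _; rewrite /= expnSr mulnA.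
rewrite !split => eq_ab.
have B_gt0 : (0 < B)%N := leq_ltn_trans (leq0n _) (ltaB ord0).
have eq0 : a ord0 = b ord0.
  by have := congr1 (modn^~ B) eq_ab; rewrite !modnMDl !modn_small.
have eqS : (\sum_(i < n) a (lift ord0 i) * B ^ i =
            \sum_(i < n) b (lift ord0 i) * B ^ i)%N.
  by move/eqP: eq_ab; rewrite eq0 eqn_add2r eqn_pmul2r // => /eqP.
move=> i; case: (unliftP ord0 i) => [j|] -> //.
by apply: (IHn (fun j => a (lift ord0 j)) (fun j => b (lift ord0 j))).
Qed.

Lemma poly_ext (K : numFieldType) (p : {poly K}) : (forall t, p.[t] = 0) -> p = 0.
Proof.
move=> p0; apply: contraTeq isT => pn0.
pose rs : seq K := [seq i%:R | i <- iota 0 (size p)].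
have uniq_rs : uniq rs.
  by rewrite map_inj_uniq ?iota_uniq // => i j /eqP; rewrite eqr_nat => /eqP.
have root_rs : all (root p) rs by apply/allP => x _; rewrite rootE p0.
by have := max_poly_roots pn0 root_rs uniq_rs; rewrite size_map size_iota ltnn.
Qed.

(** After the Kronecker substitution a polynomial that vanishes everywhere is a
    univariate polynomial with infinitely many roots. Identities between forms
    become identities in the field, where denominators can be cleared. *)
Lemma mpoly_ext (K : numFieldType) n (p q : {mpoly K[n]}) :
  (forall v, p.@[v] = q.@[v]) -> p = q.
Proof.
move=> eq_pq; apply/eqP; rewrite -subr_eq0; apply/eqP; move: (p - q) (fun v =>
  etrans (mevalB v p q) (etrans (congr1 (fun x => x - _) (eq_pq v)) (subrr _))).
move=> {eq_pq q} {}p p0; pose B := msize p.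
pose e (m : 'X_{1..n}) := (\sum_(i < n) m i * B ^ i)%N.
have Xe : \sum_(m <- msupp p) p@_m *: 'X^(e m) = 0 :> {poly K}.
  apply: poly_ext => t; rewrite -[RHS](p0 (fun i => t ^+ (B ^ i))) mevalE.
  rewrite horner_sum; apply: eq_bigr => m _.
  rewrite hornerZ hornerXn; congr (_ * _); rewrite /e -prodrXr.
  by apply: eq_bigr => i _; rewrite -exprM mulnC.
apply/mpolyP => m; rewrite mcoeff0.
case: (boolP (m \in msupp p)) => [mp|/memN_msupp_eq0 //].
have := congr1 (fun q : {poly K} => q`_(e m)) Xe.
rewrite coef0 coef_sum (bigD1_seq m) ?msupp_uniq //= coefZ coefXn eqxx mulr1.
rewrite big1_seq ?addr0 // => m' /andP[m'm m'p].
rewrite coefZ coefXn; case: eqP => [e_eq|_]; last by rewrite mulr0.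
have bound m1 : m1 \in msupp p -> forall i, (m1 i < B)%N.
  move=> m1p i; apply: leq_ltn_trans (msize_mdeg_lt m1p).
  by rewrite mdegE (bigD1 i) //= leq_addr.
case/negP: m'm; apply/eqP/mnmP => i; apply/esym.
exact: (kronecker_inj (bound _ mp) (bound _ m'p) e_eq).
Qed.

(** * Sums of cubes *)

Section SumsOfCubes.
Variables (K : numClosedFieldType) (n : nat).
Local Notation form := {mpoly K[n]}.
Local Notation cubes := (@sum_of_powers K n 3).
Implicit Types (f g l x y z : form) (a b c d e : K).

(** Over an algebraically closed field a scalar weight is itself a cube. *)
Lemma cubes_weighted r (w : 'I_r -> K) (l : 'I_r -> form) :
  (forall i, l i \is 1.-homog) -> cubes r (\sum_(i < r) w i *: l i ^+ 3).
Proof.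
move=> l_lin; exists (fun i => 3.-root (w i) *: l i); split=> [i|].
  exact/rpredZ/l_lin.
by apply: eq_bigr => i _; rewrite exprZn rootCK.
Qed.

Lemma cubes_seq (s : seq (K * form)) f :
  all (fun p => p.2 \is 1.-homog) s -> f = \sum_(p <- s) p.1 *: p.2 ^+ 3 ->
  cubes (size s) f.
Proof.
move=> /allP s_lin ->; rewrite (big_nth (0, 0)) big_mkord.
by apply: cubes_weighted => i; apply: s_lin; apply: mem_nth.
Qed.

Lemma cubesD r s f g : cubes r f -> cubes s g -> cubes (r + s) (f + g).
Proof.
move=> [l [l_lin ->]] [m [m_lin ->]].
exists (fun i => match split i with inl j => l j | inr j => m j end).
split=> [i|]; first by case: splitP.
rewrite big_split_ord; congr (_ + _); apply: eq_bigr => i _.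
  by have /= -> := unsplitK (inl i : 'I_r + 'I_s).
by have /= -> := unsplitK (inr i : 'I_r + 'I_s).
Qed.

Lemma linearX (i : 'I_n) : ('X_i : form) \is 1.-homog.
Proof. by rewrite dhomogX /= mdeg1. Qed.

End SumsOfCubes.

Ltac linear := rewrite /=;
  repeat match goal with
  | |- is_true true => done
  | |- is_true (_ && _) => apply/andP; split
  | |- is_true (_ + _ \in _) => apply: rpredD
  | |- is_true (- _ \in _) => rewrite rpredN
  | |- is_true (_ *: _ \in _) => apply: rpredZ
  | |- is_true ('X_ _ \in _) => apply: linearX
  | |- _ => assumption
  end.

Ltac expand := rewrite ?(big_cons, big_nil, big_ord_recl, big_ord0) /= -?mul_mpolyC.

Ltac form_ring := expand; ring.

Ltac pointwise := expand; apply: mpoly_ext => v;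
  rewrite !(mevalD, mevalN, mevalM, mevalXU, mevalC, rmorphXn, rmorph_nat,
    rmorph1, rmorph0) /=.

Section Pieces.
Variables (K : numClosedFieldType) (n : nat).
Local Notation form := {mpoly K[n]}.
Local Notation cubes := (@sum_of_powers K n 3).
Implicit Types (f g l x y z : form) (a b c d e : K).

Lemma char0 k : (k.+1%:R : K) != 0.
Proof. by rewrite pnatr_eq0. Qed.

(** [(x + y)^3 - (x - y)^3] is [6 x^2 y] up to a multiple of [y^3]. *)
Lemma sqr_linear_cubes x y : x \is 1.-homog -> y \is 1.-homog ->
  cubes 3 (x ^+ 2 * y).
Proof.
move=> xl yl.
apply: (cubes_seq (s := [:: (6^-1, x + y); (6^-1, y - x); (- 3^-1, y)])).
  by linear.
by pointwise; field; rewrite ?char0.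
Qed.

(** For any [a], [(a x + y + z)^3 + (a x - y - z)^3] is [6 a x (y + z)^2] up to
    a multiple of [x^3]. Subtracting the analogous expression in [b] and [y -
    z], with weights [1/a] and [1/b], leaves [24 x y z + 2 (a^2 - b^2) x^3]. *)
Lemma conic_secant_cubes e x y z :
  x \is 1.-homog -> y \is 1.-homog -> z \is 1.-homog ->
  cubes 4 (x * y * z + e *: x ^+ 3).
Proof.
move=> xl yl zl.
have [a [b [a0 b0 ab]]] : exists a b : K, [/\ a != 0, b != 0 & a ^+ 2 = 12 * e + b ^+ 2].
  (* [b = 1] works unless it forces [a = 0]. *)
  have [e0|e0] := eqVneq (12 * e + 1) 0.
    exists (sqrtC 3), 2; rewrite sqrtC_eq0 sqrtCK !char0; split=> //.
    by rewrite -[12 * e](addrK 1) e0; ring.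
  exists (sqrtC (12 * e + 1)), 1.
  by rewrite sqrtC_eq0 sqrtCK expr1n oner_eq0.
have eE : e = (a ^+ 2 - b ^+ 2) / 12 by rewrite ab; field; rewrite ?char0.
apply: (cubes_seq (s := [:: ((24 * a)^-1, a *: x + y + z);
  ((24 * a)^-1, a *: x - y - z); (- (24 * b)^-1, b *: x + y - z);
  (- (24 * b)^-1, b *: x - y + z)])).
  by linear.
by rewrite eE; pointwise; field; rewrite a0 b0 ?char0.
Qed.

Lemma xyz_cubes x y z :
  x \is 1.-homog -> y \is 1.-homog -> z \is 1.-homog -> cubes 4 (x * y * z).
Proof.
move=> xl yl zl; have := conic_secant_cubes 0 xl yl zl.
by rewrite scale0r addr0.
Qed.

(** Averaging over the cube roots of unity [w]: the sum of the cubes of [x + w y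
    + w^2 c z] keeps only the monomials invariant under [(y, z) -> (w y, w^2
    z)]. *)
Lemma hesse_cubes c x y z :
  x \is 1.-homog -> y \is 1.-homog -> z \is 1.-homog ->
  cubes 3 (x ^+ 3 + y ^+ 3 + c ^+ 3 *: z ^+ 3 + (6 * c) *: (x * y * z)).
Proof.
move=> xl yl zl.
have [w w2] : exists w : K, w ^+ 2 = - w - 1.
  exists ((- 1 + sqrtC (- 3)) / 2).
  by rewrite expr_div_n sqrrD sqrtCK; field; rewrite ?char0.
apply: (cubes_seq (s := [:: (3^-1, x + y + c *: z);
   (3^-1, x + w *: y + (c * w ^+ 2) *: z);
   (3^-1, x + w ^+ 2 *: y + (c * w) *: z)])).
  by linear.
by pointwise; field: w2; rewrite ?char0.
Qed.

(** After scaling the variables, a suitable multiple of [z^3] turns the nodal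
    cubic into a member of the Hesse pencil that is a sum of three cubes. *)
Lemma nodal_cubes a b x y z : a != 0 -> b != 0 ->
  x \is 1.-homog -> y \is 1.-homog -> z \is 1.-homog ->
  cubes 4 (x * y * z + a *: x ^+ 3 + b *: y ^+ 3).
Proof.
move=> a0 b0 xl yl zl.
set s := 3.-root a; set t := 3.-root b.
have [s3 t3] : s ^+ 3 = a /\ t ^+ 3 = b by rewrite !rootCK.
have s0 : s != 0 by rewrite rootC_eq0.
have t0 : t != 0 by rewrite rootC_eq0.
set z' := (s * t)^-1 *: z.
have z'l : z' \is 1.-homog by apply: rpredZ.
have -> : x * y * z + a *: x ^+ 3 + b *: y ^+ 3 =
  ((s *: x) ^+ 3 + (t *: y) ^+ 3 + (6^-1) ^+ 3 *: z' ^+ 3 +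
   (6 * 6^-1) *: ((s *: x) * (t *: y) * z')) + (- 6^-1 ^+ 3) *: z' ^+ 3.
  by rewrite -s3 -t3 /z'; pointwise; field; rewrite ?char0 ?s0 ?t0.
apply: (@cubesD _ _ 3 1); first by apply: hesse_cubes; linear.
apply: (cubes_seq (s := [:: (- 6^-1 ^+ 3, z')])); first by linear.
by rewrite big_seq1.
Qed.

(** * Sylvester's method *)

Lemma closed_separable (p : {poly K}) :
  (forall t, p.[t] = 0 -> p^`().[t] = 0 -> False) -> separable_poly p.
Proof.
move=> no_root; rewrite unlock /coprimep; apply/negPn/negP => /closed_rootP[t].
by rewrite root_gcd => /andP[/rootP pt /rootP qt]; apply: no_root pt qt.
Qed.

(** The weights are determined by the first [r] terms, because the Vandermonde
    matrix of distinct roots is invertible; both sides satisfy the recurrence of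
    [p], which propagates the equality. *)
Lemma sylvester (p : {poly K}) r m (c : nat -> K) :
  p \is monic -> size p = r.+1 -> separable_poly p ->
  (forall k, (k < m)%N -> \sum_(i < r.+1) p`_i * c (k + i)%N = 0) ->
  exists w lam : 'I_r -> K,
    forall k, (k < r + m)%N -> c k = \sum_(j < r) w j * lam j ^+ k.
Proof.
move=> p_monic p_size p_sep c_rec.
have [rs] := closed_field_poly_normal p.
rewrite (monicP p_monic) scale1r => pE.
have rs_uniq : uniq rs by rewrite -separable_prod_XsubC -pE.
have rs_size : size rs = r by move: p_size; rewrite pE size_prod_XsubC => -[].
pose lam (j : 'I_r) := rs`_j.
pose V := Vandermonde r (\row_j lam j).
have V_unit : V \in unitmx.
  rewrite unitmxE det_Vandermonde unitfE; apply/prodf_neq0 => i _.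
  apply/prodf_neq0 => j ij; rewrite !mxE subr_eq0 /lam.
  by rewrite nth_uniq ?rs_size // gtn_eqF.
pose w := invmx V *m \col_(i < r) c i.
have lam_root j : \sum_(i < r.+1) p`_i * lam j ^+ i = 0.
  rewrite -p_size -horner_coef; apply/rootP; rewrite pE root_prod_XsubC.
  by rewrite mem_nth ?rs_size.
exists (fun j => w j 0), lam; elim/ltn_ind => k IHk km.
have [kr|rk] := ltnP k r.
  transitivity ((V *m w) (Ordinal kr) 0); first by rewrite mulKVmx // mxE.
  by rewrite mxE; apply: eq_bigr => j _; rewrite !mxE mulrC.
have top (u : nat -> K) : \sum_(i < r.+1) p`_i * u (k - r + i)%N = 0 ->
    u k = - \sum_(i < r) p`_i * u (k - r + i)%N.
  rewrite big_ord_recr /= subnK // (_ : p`_r = 1) ?mul1r.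
    by move/eqP; rewrite addrC addr_eq0 => /eqP.
  by have := monicP p_monic; rewrite lead_coefE p_size.
rewrite top; last by apply: c_rec; rewrite ltn_subLR.
rewrite (top (fun k => \sum_(j < r) w j 0 * lam j ^+ k)).
  congr (- _); apply: eq_bigr => i _; congr (_ * _).
  have ik : (k - r + i < k)%N by rewrite -ltn_subRL subKn.
  by apply: IHk ik (ltn_trans ik km).
under eq_bigr => i _ do rewrite mulr_sumr.
rewrite exchange_big big1 // => j _.
transitivity (w j 0 * lam j ^+ (k - r) * \sum_(i < r.+1) p`_i * lam j ^+ i).
  by rewrite mulr_sumr; apply: eq_bigr => i _; rewrite exprD; ring.
by rewrite lam_root mulr0.
Qed.

(** If [l t ^+ 3] has coefficients [A k] in [t], any combination of the [A k]
    whose coefficients satisfy a recurrence with distinct characteristic roots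
    is a combination of the cubes of [l] at these roots. *)
Lemma curve_cubes (p : {poly K}) r m N (c : nat -> K) (l : K -> form) (A : nat -> form) :
  N = (r + m)%N -> p \is monic -> size p = r.+1 -> separable_poly p ->
  (forall k, (k < m)%N -> \sum_(i < r.+1) p`_i * c (k + i)%N = 0) ->
  (forall t, l t \is 1.-homog) ->
  (forall t, l t ^+ 3 = \sum_(k < N) t ^+ k *: A k) ->
  cubes r (\sum_(k < N) c k *: A k).
Proof.
move=> NE p_monic p_size p_sep c_rec l_lin lE.
have [w [lam cE]] := sylvester p_monic p_size p_sep c_rec.
suff -> : \sum_(k < N) c k *: A k = \sum_(j < r) w j *: l (lam j) ^+ 3.
  exact: cubes_weighted.
transitivity (\sum_(k < N) \sum_(j < r) (w j * lam j ^+ k) *: A k).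
  by apply: eq_bigr => k _; rewrite cE -?NE // scaler_suml.
rewrite exchange_big; apply: eq_bigr => j _; rewrite lE scaler_sumr.
by apply: eq_bigr => k _; rewrite scalerA.
Qed.

(** The linear form runs over the pencil [x + t y]. The sequence [a, b, c, d]
    satisfies a recurrence of order 2 whose characteristic polynomial is, up to
    the sign of the variable, the Hessian of the cubic; the second condition
    says that the cubic, or equivalently its Hessian, has nonzero discriminant.
    *)
Lemma binary_cubic_cubes a b c d x y :
  a * c != b ^+ 2 ->
  (b * c - a * d) ^+ 2 != 4 * (b * d - c ^+ 2) * (a * c - b ^+ 2) ->
  x \is 1.-homog -> y \is 1.-homog ->
  cubes 2 (a *: x ^+ 3 + (3 * b) *: (x ^+ 2 * y) + (3 * c) *: (x * y ^+ 2)
           + d *: y ^+ 3).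
Proof.
move=> ac disc xl yl.
have D0 : a * c - b ^+ 2 != 0 by rewrite subr_eq0.
have [p1 [p0 [p1D p0D rec0 rec1]]] : exists p1 p0 : K,
    [/\ b * c - a * d = p1 * (a * c - b ^+ 2),
        b * d - c ^+ 2 = p0 * (a * c - b ^+ 2),
        p0 * a + p1 * b + c = 0 & p0 * b + p1 * c + d = 0].
  exists ((b * c - a * d) / (a * c - b ^+ 2)).
  exists ((b * d - c ^+ 2) / (a * c - b ^+ 2)).
  by rewrite !mulfVK //; split=> //; field.
pose p : {poly K} := Poly [:: p0; p1; 1].
have pE : p = [:: p0; p1; 1] :> seq K by rewrite (@PolyK _ 0) //= oner_eq0.
have := @curve_cubes p 2 2 4 (nth 0 [:: a; b; c; d]) (fun t => x + t *: y)
  (nth 0 [:: x ^+ 3; 3 * x ^+ 2 * y; 3 * x * y ^+ 2; y ^+ 3]).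
set S := \sum_(k < _) _ => cubesS.
have -> : a *: x ^+ 3 + (3 * b) *: (x ^+ 2 * y) + (3 * c) *: (x * y ^+ 2)
           + d *: y ^+ 3 = S by rewrite /S; form_ring.
apply: cubesS => [|||||t|t].
- by [].
- by rewrite monicE lead_coefE pE.
- by rewrite pE.
- apply: closed_separable => t; rewrite /p /= !cons_poly_def !derivE !hornerE.
  move=> pt dpt; case/eqP: disc; apply/eqP; rewrite -subr_eq0.
  have p1E : p1 = - (2 * t).
    by apply/eqP; rewrite -addr_eq0 -dpt; apply/eqP; ring.
  have p0E : p0 = t ^+ 2.
    by rewrite -[RHS]addr0 -pt p1E; ring.
  by apply/eqP; rewrite p1D p0D p1E p0E; ring.
- case=> [|[|k]] //= _; rewrite !big_ord_recr big_ord0 /= pE add0r mul1r.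
    exact: rec0.
  exact: rec1.
- by linear.
- by form_ring.
Qed.

(** The linear form [l0 + t l1 + t^2 l2 + t^3 l3] runs over a twisted cubic in
    the dual space, and the displayed cubics are the coefficients of its cube.
    *)
Lemma twisted_cubic_cubes (p : {poly K}) r m (c : nat -> K) (l0 l1 l2 l3 : form) :
  (r + m)%N = 10%N -> p \is monic -> size p = r.+1 -> separable_poly p ->
  (forall k, (k < m)%N -> \sum_(i < r.+1) p`_i * c (k + i)%N = 0) ->
  l0 \is 1.-homog -> l1 \is 1.-homog -> l2 \is 1.-homog -> l3 \is 1.-homog ->
  cubes r (c 0%N *: l0 ^+ 3 + (3 * c 1%N) *: (l0 ^+ 2 * l1)
    + (3 * c 2%N) *: (l0 ^+ 2 * l2 + l0 * l1 ^+ 2)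
    + c 3%N *: (l1 ^+ 3 + 6 * l0 * l1 * l2 + 3 * l0 ^+ 2 * l3)
    + (3 * c 4%N) *: (l1 ^+ 2 * l2 + l0 * l2 ^+ 2 + 2 * l0 * l1 * l3)
    + (3 * c 5%N) *: (l1 * l2 ^+ 2 + l1 ^+ 2 * l3 + 2 * l0 * l2 * l3)
    + c 6%N *: (l2 ^+ 3 + 6 * l1 * l2 * l3 + 3 * l0 * l3 ^+ 2)
    + (3 * c 7%N) *: (l2 ^+ 2 * l3 + l1 * l3 ^+ 2)
    + (3 * c 8%N) *: (l2 * l3 ^+ 2) + c 9%N *: l3 ^+ 3).
Proof.
move=> rm p_monic p_size p_sep c_rec l0l l1l l2l l3l.
have := curve_cubes (l := fun t => l0 + t *: l1 + t ^+ 2 *: l2 + t ^+ 3 *: l3)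
  (A := nth 0 [:: l0 ^+ 3; 3 * l0 ^+ 2 * l1; 3 * l0 ^+ 2 * l2 + 3 * l0 * l1 ^+ 2;
    l1 ^+ 3 + 6 * l0 * l1 * l2 + 3 * l0 ^+ 2 * l3;
    3 * l1 ^+ 2 * l2 + 3 * l0 * l2 ^+ 2 + 6 * l0 * l1 * l3;
    3 * l1 * l2 ^+ 2 + 3 * l1 ^+ 2 * l3 + 6 * l0 * l2 * l3;
    l2 ^+ 3 + 6 * l1 * l2 * l3 + 3 * l0 * l3 ^+ 2;
    3 * l2 ^+ 2 * l3 + 3 * l1 * l3 ^+ 2; 3 * l2 * l3 ^+ 2; l3 ^+ 3])
  (esym rm) p_monic p_size p_sep c_rec.
set S := \sum_(k < _) _ => cubesS.
set f := (X in cubes r X); have -> : f = S by rewrite /f /S; form_ring.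
by apply: cubesS => t; [linear | form_ring].
Qed.
End Pieces.

(** * The pentahedron of a nodal cubic surface *)

(** The quintic whose roots are the parameters, on a twisted cubic, of the five
    linear forms attached to the sextic [s^5 t + c3 s^3 t^3 + c2 s^2 t^4 + c1 s
    t^5 + c0 t^6]. *)
Definition node_quintic (A : comNzRingType) (c3 c2 c1 c0 : A) : {poly A} :=
  Poly [:: 12 * c2 * c3 + 24 * c0; 9 * c3 ^+ 2 - 4 * c1; 4 * c2; 6 * c3; 0; 1].

Lemma node_quinticE (A : comNzRingType) (c3 c2 c1 c0 : A) :
  node_quintic c3 c2 c1 c0 =
  [:: 12 * c2 * c3 + 24 * c0; 9 * c3 ^+ 2 - 4 * c1; 4 * c2; 6 * c3; 0; 1] :> seq A.
Proof. by rewrite (@PolyK _ 0) //= oner_eq0. Qed.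

Section Nodal.
Variables (K : numClosedFieldType) (n : nat).
Local Notation form := {mpoly K[n]}.
Local Notation cubes := (@sum_of_powers K n 3).

(** The five linear forms have degree at most 3 in the parameter and take the
    value 1 at [(0, 0, 0, 1)], so that this point is singular as soon as the
    moments [sum_j w_j t_j^k] of the weights vanish for [k <= 3]. The higher
    moments that produce the given form are then determined one after the other
    by the coefficients of the sextic, and [node_quintic] is the characteristic
    polynomial of their recurrence. *)
Lemma node_cubes (c3 c2 c1 c0 : K) (x1 x2 x3 x4 : form) :
  separable_poly (node_quintic c3 c2 c1 c0) ->
  x1 \is 1.-homog -> x2 \is 1.-homog -> x3 \is 1.-homog -> x4 \is 1.-homog ->
  cubes 5 (x4 * (x2 ^+ 2 - x1 * x3) + x1 ^+ 2 * x2 + c3 *: x2 ^+ 3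
    + c2 *: (x2 ^+ 2 * x3) + c1 *: (x2 * x3 ^+ 2) + c0 *: x3 ^+ 3).
Proof.
move=> p_sep x1l x2l x3l x4l.
have := twisted_cubic_cubes (m := 5) (r := 5)
  (c := nth 0 [:: 0; 0; 0; 0; 3^-1; 0; - 2 * c3; - (4 / 3) * c2;
           4 / 3 * c1 + 9 * c3 ^+ 2; 12 * c2 * c3 - 8 * c0])
  (l0 := x4 + (3 * c3) *: x2 - c2 *: x3) (l1 := x1 - (3 / 2 * c3) *: x3)
  (l2 := x2) (l3 := - 2^-1 *: x3) (p := node_quintic c3 c2 c1 c0).
set f := (X in cubes 5 X) => cubesf.
set g := (X in cubes 5 X).
have -> : g = f.
  by rewrite /f /g; pointwise; field; rewrite ?char0.
apply: cubesf => //; try by linear.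
- by rewrite monicE lead_coefE node_quinticE.
- by rewrite node_quinticE.
move=> k k5; rewrite !big_ord_recr big_ord0 /= node_quinticE.
by case: k k5 => [|[|[|[|[|k]]]]] // _; rewrite /addn /=; field; rewrite ?char0.
Qed.
End Nodal.

(** * Discriminants over the parameter space *)

(** The sextic of the form A1 has roots infinity, 0, 1, [r1], [r2], [r3]; here
    [p] stands for the mean of the five finite ones, and translating by [p]
    removes the term [s^4 t^2]. *)
Definition A1_quintic (A : comNzRingType) (p r1 r2 r3 : A) : {poly A} :=
  let e1 := 1 + r1 + r2 + r3 in
  let e2 := r1 + r2 + r3 + r1 * r2 + r1 * r3 + r2 * r3 in
  let e3 := r1 * r2 + r1 * r3 + r2 * r3 + r1 * r2 * r3 in
  let e4 := r1 * r2 * r3 in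
  node_quintic (e2 - 4 * p * e1 + 10 * p ^+ 2)
    (10 * p ^+ 3 - 6 * p ^+ 2 * e1 + 3 * p * e2 - e3)
    (5 * p ^+ 4 - 4 * p ^+ 3 * e1 + 3 * p ^+ 2 * e2 - 2 * p * e3 + e4)
    (p ^+ 5 - p ^+ 4 * e1 + p ^+ 3 * e2 - p ^+ 2 * e3 + p * e4).

Lemma map_node_quintic (A B : comNzRingType) (h : {rmorphism A -> B}) c3 c2 c1 c0 :
  map_poly h (node_quintic c3 c2 c1 c0) = node_quintic (h c3) (h c2) (h c1) (h c0).
Proof.
apply/polyP => i; rewrite coef_map !node_quinticE.
by case: i => [|[|[|[|[|[|i]]]]]]; rewrite /= ?nth_nil;
  rewrite !(rmorph_nat, rmorphD, rmorphN, rmorphM, rmorphXn, rmorph0, rmorph1).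
Qed.

Lemma map_A1_quintic (A B : comNzRingType) (h : {rmorphism A -> B}) p r1 r2 r3 :
  map_poly h (A1_quintic p r1 r2 r3) = A1_quintic (h p) (h r1) (h r2) (h r3).
Proof.
by rewrite /A1_quintic map_node_quintic
  !(rmorph_nat, rmorphD, rmorphN, rmorphM, rmorphXn, rmorph1).
Qed.

Lemma size_A1_quintic (A : comNzRingType) (p r1 r2 r3 : A) :
  size (A1_quintic p r1 r2 r3) = 6%N.
Proof. by rewrite node_quinticE. Qed.

Lemma monic_A1_quintic (A : comNzRingType) (p r1 r2 r3 : A) :
  A1_quintic p r1 r2 r3 \is monic.
Proof. by rewrite monicE lead_coefE node_quinticE. Qed.

(** The Sylvester matrix commutes with a morphism as long as the degrees do not
    drop. *)
Lemma rmorph_resultant (A B : nzRingType) (h : {rmorphism A -> B}) (p q : {poly A}) :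
  h (lead_coef p) != 0 -> h (lead_coef q) != 0 ->
  h (resultant p q) = resultant (map_poly h p) (map_poly h q).
Proof.
move=> hp hq; rewrite /resultant /Sylvester_mx !size_map_poly_id0 //.
rewrite -det_map_mx map_col_mx; congr (\det (col_mx _ _));
  by apply: map_lin1_mx => v; rewrite /= map_poly_rV rmorphM /= map_rVpoly.
Qed.

Section Discriminant.
Variables (K : numClosedFieldType) (n : nat) (s1 s2 s3 : {mpoly K[n]}).

Let p : {mpoly K[n]} := 5^-1 *: (1 + s1 + s2 + s3).
Let P : {poly {mpoly K[n]}} := A1_quintic p s1 s2 s3.
Let spec v : {poly K} :=
  A1_quintic (5^-1 * (1 + s1.@[v] + s2.@[v] + s3.@[v])) s1.@[v] s2.@[v] s3.@[v].

Definition A1_discriminant : {mpoly K[n]} := resultant P P^`().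

Lemma A1_discriminant_neq0 v :
  (A1_discriminant.@[v] != 0) =
  separable_poly (A1_quintic (5^-1 * (1 + s1.@[v] + s2.@[v] + s3.@[v]))
    s1.@[v] s2.@[v] s3.@[v]).
Proof.
have PE : map_poly (meval v) P = spec v.
  by rewrite map_A1_quintic /spec /p /= mevalZ !mevalD meval1.
have P'4 : P^`()`_4 = 5 by rewrite coef_deriv node_quinticE.
have five : (5 : {mpoly K[n]}).@[v] != 0 by rewrite rmorph_nat pnatr_eq0.
have P'_size : size P^`() = 5%N.
  apply/eqP; rewrite eqn_leq; apply/andP; split.
    have P_size : size P = 6%N by apply: size_A1_quintic.
    by rewrite -ltnS -P_size lt_size_deriv // -size_poly_eq0 P_size.
  rewrite ltnNge; apply: contra five => /leq_sizeP/(_ 4)/(_ isT).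
  by rewrite P'4 => ->; rewrite meval0.
have P'_lead : lead_coef P^`() = 5 by rewrite lead_coefE P'_size.
rewrite -/(spec v) -PE unlock /coprimep deriv_map /A1_discriminant rmorph_resultant.
- rewrite resultant_eq0 -leqNgt eqn_leq lt0n size_poly_eq0 gcdp_eq0 andbC.
  rewrite [in X in ~~ X]PE negb_and -size_poly_eq0 size_A1_quintic //.
- by rewrite (monicP (monic_A1_quintic _ _ _ _)) rmorph1 oner_eq0.
- by rewrite P'_lead.
Qed.
End Discriminant.

Section A1.
Variable K : numClosedFieldType.
Local Notation cubes := (@sum_of_powers K 4 3).

(** The substitution [s := s + p t] on the conic acts on the plane as the second
    symmetric power, which fixes [x2^2 - x1 x3]; the change of [x4] absorbs the
    difference between cubics with the same restriction to the conic. *)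
Lemma form_A1_cubes (p r1 r2 r3 : K) : 5 * p = 1 + r1 + r2 + r3 ->
  separable_poly (A1_quintic p r1 r2 r3) -> cubes 5 (form_A1 r1 r2 r3).
Proof.
move=> pE; have {pE}r3E : r3 = 5 * p - 1 - r1 - r2 by rewrite pE; ring.
move=> p_sep; have cubesf := @node_cubes K 4 _ _ _ _
  ('X_0 - (2 * p) *: 'X_1 + p ^+ 2 *: 'X_2) ('X_1 - p *: 'X_2) 'X_2
  ('X_3 - p *: 'X_0 + (6 * p ^+ 2 - r1 - r2 * r3) *: 'X_1 - (2 * p ^+ 3) *: 'X_2)
  p_sep.
set f := (X in cubes 5 X) in cubesf.
suff -> : form_A1 r1 r2 r3 = f by apply: cubesf; linear.
by rewrite /f /form_A1; pointwise; ring: r3E.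
Qed.

Lemma A1_discriminant_cubes n (s1 s2 s3 : {mpoly K[n]}) v :
  (A1_discriminant s1 s2 s3).@[v] != 0 ->
  cubes 5 (form_A1 s1.@[v] s2.@[v] s3.@[v]).
Proof.
rewrite A1_discriminant_neq0; apply: form_A1_cubes; field.
by rewrite ?char0.
Qed.

Lemma form_2A1E (r1 r2 : K) : form_2A1 r1 r2 = form_A1 r1 r2 0.
Proof. by rewrite /form_2A1 /form_A1; form_ring. Qed.

Lemma separable_node_quintic (c3 c2 c1 c0 : K) :
  (forall t, t ^+ 5 + 6 * c3 * t ^+ 3 + 4 * c2 * t ^+ 2
             + (9 * c3 ^+ 2 - 4 * c1) * t + (12 * c2 * c3 + 24 * c0) = 0 ->
    5 * t ^+ 4 + 18 * c3 * t ^+ 2 + 8 * c2 * t + (9 * c3 ^+ 2 - 4 * c1) = 0 ->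
    False) ->
  separable_poly (node_quintic c3 c2 c1 c0).
Proof.
move=> no_root; apply: closed_separable => t.
move: (no_root t); rewrite /node_quintic.
move: (12 * c2 * c3 + 24 * c0) (9 * c3 ^+ 2 - 4 * c1) => d0 d1 {}no_root.
rewrite /= !cons_poly_def !derivE !hornerE => pt dpt.
by apply: no_root; [rewrite -[RHS]pt | rewrite -[RHS]dpt]; ring.
Qed.

(** The quintic is [t (t^2 - 11) (t^2 - 19)]. *)
Lemma separable_A1_example (p : K) : p = 5^-1 * (1 + -1 + 2 + -2) ->
  separable_poly (A1_quintic p (-1) 2 (-2)).
Proof.
have -> : 5^-1 * (1 + -1 + 2 + -2) = 0 :> K by rewrite subrr add0r subrr mulr0.
move=> ->.
have -> : A1_quintic 0 (-1) 2 (-2) = node_quintic (-5) 0 4 0 :> {poly K}.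
  by congr node_quintic; ring.
apply: separable_node_quintic => t pt dpt.
have e1 : t * ((t ^+ 2 - 11) * (t ^+ 2 - 19)) = 0 by rewrite -[RHS]pt; ring.
have e2 : 5 * (t ^+ 2) ^+ 2 - 90 * t ^+ 2 + 209 = 0 by rewrite -[RHS]dpt; ring.
have t2 : [|| t ^+ 2 == 0, t ^+ 2 == 11 | t ^+ 2 == 19].
  by move/eqP: e1; rewrite !mulf_eq0 !subr_eq0 => /or3P[/eqP->|->|->];
    rewrite ?expr0n ?eqxx ?orbT.
case/or3P: t2 e2 => /eqP -> e2.
- by case/eqP: (char0 K 208); rewrite -[RHS]e2; ring.
- by case/eqP: (char0 K 175); rewrite -[RHS]oppr0 -e2; ring.
- by case/eqP: (char0 K 303); rewrite -[RHS]e2; ring.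
Qed.

(** In the variable [s = t - 2/5] the quintic and its derivative are integral,
    and a Bezout relation between them has constant term [51520 = 64 * 805]. *)
Lemma separable_2A1_example (p : K) : p = 5^-1 * (1 + -1 + 2 + 0) ->
  separable_poly (A1_quintic p (-1) 2 0).
Proof.
move=> ->.
have -> : A1_quintic (5^-1 * (1 + -1 + 2 + 0)) (-1) 2 0 =
    node_quintic (- 13 / 5) (- 12 / 25) (92 / 125) (672 / 3125) :> {poly K}.
  by congr node_quintic; field; rewrite ?char0.
apply: separable_node_quintic => t.
have [s ->] : exists s, t = s + 2 / 5 by exists (t - 2 / 5); rewrite subrK.
move=> pt dpt.
have e1 : s ^+ 5 + 2 * s ^+ 4 - 14 * s ^+ 3 - 20 * s ^+ 2 + 49 * s + 42 = 0.
  by rewrite -[RHS]pt; field; rewrite ?char0.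
have e2 : 5 * s ^+ 4 + 8 * s ^+ 3 - 42 * s ^+ 2 - 40 * s + 49 = 0.
  by rewrite -[RHS]dpt; field; rewrite ?char0.
have := mulr0 (998 + 1197 * s - 1398 * s ^+ 2 - 655 * s ^+ 3).
rewrite -{1}e1 => b1.
have := mulr0 (196 - 1864 * s - 945 * s ^+ 2 + 332 * s ^+ 3 + 131 * s ^+ 4).
rewrite -{1}e2 => b2.
have : 64 * 805 = 0 :> K by rewrite -[RHS]addr0 -{1}b1 -b2; ring.
by apply/eqP; rewrite mulf_neq0 ?char0.
Qed.
End A1.

(** * Decompositions of the normal forms *)

Section Upper.
Variable K : numClosedFieldType.
Local Notation cubes := (@sum_of_powers K 4 3).
Local Notation x1 := ('X_0 : {mpoly K[4]}).
Local Notation x2 := ('X_1 : {mpoly K[4]}).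
Local Notation x3 := ('X_2 : {mpoly K[4]}).
Local Notation x4 := ('X_3 : {mpoly K[4]}).
Implicit Types (rho d : K) (x y : {mpoly K[4]}).

Ltac nonzero := rewrite /=;
  repeat match goal with
  | |- is_true (_ * _ != 0) => apply: mulf_neq0
  | |- is_true (_^-1 != 0) => apply: invr_neq0
  | |- is_true (- _ != 0) => rewrite oppr_eq0
  | |- is_true (_ ^+ _ != 0) => apply: expf_neq0
  | |- is_true (1 != 0) => apply: oner_neq0
  | |- is_true (_%:R != 0) => apply: char0
  | |- _ => assumption
  end.

(** The binary cubic [y (x^2 + d y^2)] has distinct roots. *)
Lemma square_cube_cubes d x y : d != 0 -> x \is 1.-homog -> y \is 1.-homog ->
  cubes 2 (x ^+ 2 * y + d *: y ^+ 3).
Proof.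
move=> d0 xl yl.
have -> : x ^+ 2 * y + d *: y ^+ 3 =
    0 *: x ^+ 3 + (3 * 3^-1) *: (x ^+ 2 * y) + (3 * 0) *: (x * y ^+ 2) + d *: y ^+ 3.
  by pointwise; field; rewrite ?char0.
apply: binary_cubic_cubes => //.
  by rewrite mul0r eq_sym expf_neq0 ?invr_neq0 ?char0.
rewrite -subr_eq0; set e := (X in X != 0).
have -> : e = 4 / 27 * d by rewrite /e; field; rewrite ?char0.
by nonzero.
Qed.

(** With [X = x1], [Y = rho x3], [Z = x4] and [s = X + Y + Z], the cubes of [X -
    s/2], [Y - s/2], [Z - s/2] have sum [3 X Y Z - s^3/8]. The rest is a binary
    cubic in [x2] and [s], and the condition on [rho] is that its discriminant
    is nonzero. *)
Lemma form_3A1_cubes rho : rho != 0 -> rho ^+ 2 != 14 / 9 * rho - 1 ->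
  cubes 5 (form_3A1 rho).
Proof.
move=> rho0 rhoN; pose s := x1 + rho *: x3 + x4.
have sl : s \is 1.-homog by rewrite /s; linear.
have -> : form_3A1 rho =
    (- (3 * rho)^-1 *: (x1 - 2^-1 *: s) ^+ 3
     + - (3 * rho)^-1 *: (rho *: x3 - 2^-1 *: s) ^+ 3
     + - (3 * rho)^-1 *: (x4 - 2^-1 *: s) ^+ 3)
    + ((- (1 + rho)) *: x2 ^+ 3 + (3 * 3^-1) *: (x2 ^+ 2 * s)
       + (3 * 0) *: (x2 * s ^+ 2) + (- (24 * rho)^-1) *: s ^+ 3).
  by rewrite /form_3A1 /s; pointwise; field; rewrite ?char0 rho0.
apply: (@cubesD _ _ 3 2).
  apply: (cubes_seq (s := [:: (- (3 * rho)^-1, x1 - 2^-1 *: s);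
    (- (3 * rho)^-1, rho *: x3 - 2^-1 *: s); (- (3 * rho)^-1, x4 - 2^-1 *: s)])).
    by linear.
  by rewrite !big_cons big_nil addr0 addrA.
apply: binary_cubic_cubes => //; last by linear.
  by rewrite mulr0 eq_sym expf_neq0 ?invr_neq0 ?char0.
(* Clearing denominators in the discriminant gives the excluded equation. *)
apply: contra rhoN => /eqP e; rewrite -subr_eq0; apply/eqP.
transitivity ((24 * rho) ^+ 2 * ((3^-1 * 0 - - (1 + rho) * (- (24 * rho)^-1)) ^+ 2
  - 4 * (3^-1 * (- (24 * rho)^-1) - 0 ^+ 2) * (- (1 + rho) * 0 - 3^-1 ^+ 2))).
  by field; rewrite ?char0 rho0.
by rewrite e subrr mulr0.
Qed.

Lemma form_4A1_cubes : cubes 5 (form_4A1).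
Proof.
have -> : form_4A1 = form_3A1 1 :> {mpoly K[4]}.
  by rewrite /form_4A1 /form_3A1; form_ring.
apply: form_3A1_cubes; rewrite ?oner_eq0 // -subr_eq0.
have -> : 1 ^+ 2 - (14 / 9 * 1 - 1) = 4 / 9 :> K by field; rewrite ?char0.
by nonzero.
Qed.

(** For this [rho], the restriction of the form to the plane [y = 0] is the sum
    of multiples of [x^3] and [x1^3]. So the form is, modulo [x1 y], a binary
    cubic in [x] and [y] plus a multiple of [x1^3]. A multiple of [y^3] is moved
    between the nodal and the binary part to make both nondegenerate. *)
Lemma form_A1A2_cubes rho : rho != 0 -> rho ^+ 2 = rho - 1 ->
  cubes 6 (form_A1A2 rho).
Proof.
move=> rho0 rho2.
have rho1 : 1 + rho != 0.
  apply/eqP => e; case/eqP: (char0 K 2); move: rho2.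
  have -> : rho = - 1 by rewrite -[LHS]addr0 -(subrr 1) addrA (addrC rho) e add0r.
  move=> e2; transitivity ((-1) ^+ 2 - (-1 - 1) : K); first by ring.
  by rewrite e2 subrr.
pose t := (1 + rho) / (3 * rho); pose x := x2 - t *: x1; pose y := rho *: x2 - x4.
have [xl yl] : x \is 1.-homog /\ y \is 1.-homog by split; rewrite /x /y; linear.
have -> : form_A1A2 rho =
    (x1 * y * (x3 - (2 * t) *: x2 + t ^+ 2 *: x1) + (rho * t ^+ 3) *: x1 ^+ 3
     + (- (6 * rho ^+ 2)^-1) *: y ^+ 3)
    + (rho *: x ^+ 3 + (3 * - 3^-1) *: (x ^+ 2 * y) + (3 * 0) *: (x * y ^+ 2)
       + (6 * rho ^+ 2)^-1 *: y ^+ 3).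
  by rewrite /form_A1A2 /x /y /t; pointwise; field: rho2; rewrite ?char0 rho0.
apply: (@cubesD _ _ 4 2).
  apply: nodal_cubes; try by linear.
    by rewrite /t; nonzero.
  by nonzero.
apply: binary_cubic_cubes => //.
  by rewrite mulr0 eq_sym expf_neq0 ?oppr_eq0 ?invr_neq0 ?char0.
rewrite -subr_eq0; set e := (X in X != 0).
have -> : e = 1 / (324 * rho ^+ 2) by rewrite /e; field; rewrite ?char0 rho0.
by nonzero.
Qed.
(** Modulo [x1 x4] the cube of [m = x1 + x4] is [x1^3 + x4^3]. Moving a multiple
    of it between the two parts makes the binary cubic in [x2] and [m] have
    distinct roots and the plane cubic nodal. *)
Lemma form_2A1A2_cubes : cubes 6 (form_2A1A2).
Proof.
pose m := x1 + x4; have ml : m \is 1.-homog by rewrite /m; linear.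
have -> : form_2A1A2 =
    (x1 * x4 * (2^-1 *: m - x3) + 6^-1 *: x1 ^+ 3 + 6^-1 *: x4 ^+ 3)
    + ((- 1) *: x2 ^+ 3 + (3 * 3^-1) *: (x2 ^+ 2 * m) + (3 * 0) *: (x2 * m ^+ 2)
       + (- 6^-1) *: m ^+ 3) :> {mpoly K[4]}.
  by rewrite /form_2A1A2 /m; pointwise; field; rewrite ?char0.
apply: (@cubesD _ _ 4 2); first by apply: nodal_cubes; try linear; nonzero.
apply: binary_cubic_cubes => //; last by linear.
  by rewrite mulr0 eq_sym; nonzero.
rewrite -subr_eq0; set e := (X in X != 0).
have -> : e = 1 / 324 by rewrite /e; field; rewrite ?char0.
by nonzero.
Qed.

Lemma form_A1_2A2_cubes : cubes 6 (form_A1_2A2).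
Proof.
have -> : form_A1_2A2 =
    (x4 * x1 * (- x3) + 1 *: x4 ^+ 3)
    + (1 *: x2 ^+ 3 + (3 * 3^-1) *: (x2 ^+ 2 * x4) + (3 * 0) *: (x2 * x4 ^+ 2)
       + (- 1) *: x4 ^+ 3) :> {mpoly K[4]}.
  by rewrite /form_A1_2A2; pointwise; field; rewrite ?char0.
apply: (@cubesD _ _ 4 2); first by apply: conic_secant_cubes; linear.
apply: binary_cubic_cubes; try by linear.
  by rewrite mulr0 eq_sym; nonzero.
rewrite -subr_eq0; set e := (X in X != 0).
have -> : e = 23 / 27 by rewrite /e; field; rewrite ?char0.
by nonzero.
Qed.

(** Completing the square in [x2] modulo [x1 x4] leaves a binary cubic and a
    multiple of [x1^3]; the cube of [x4 - x1], which is [x4^3 - x1^3] modulo [x1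
    x4], trades the latter for a multiple of [x4^3]. *)
Lemma form_A1A3_cubes : cubes 6 (form_A1A3).
Proof.
have -> : form_A1A3 =
    (x4 * x1 * (x2 - x3 + 2^-1 *: x1 - (3 / 4) *: x4) + 4^-1 *: x4 ^+ 3)
    + ((x2 - 2^-1 *: x1) ^+ 2 * (x4 - x1) + (- 4^-1) *: (x4 - x1) ^+ 3)
    :> {mpoly K[4]}.
  by rewrite /form_A1A3; pointwise; field; rewrite ?char0.
apply: (@cubesD _ _ 4 2); first by apply: conic_secant_cubes; linear.
by apply: square_cube_cubes; try linear; nonzero.
Qed.

(** As for 2A1A2, the cube of [x1 + x4] is moved between the two parts. *)
Lemma form_2A1A3_cubes : cubes 6 (form_2A1A3).
Proof.
have -> : form_2A1A3 =
    (x1 * x4 * (3 *: (x1 + x4) - x3) + 1 *: x1 ^+ 3 + 1 *: x4 ^+ 3)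
    + (x2 ^+ 2 * (x1 + x4) + (- 1) *: (x1 + x4) ^+ 3) :> {mpoly K[4]}.
  by rewrite /form_2A1A3; form_ring.
apply: (@cubesD _ _ 4 2); first by apply: nodal_cubes; try linear; nonzero.
by apply: square_cube_cubes; try linear; nonzero.
Qed.

Lemma form_A1A5_cubes : cubes 6 (form_A1A5).
Proof.
have -> : form_A1A5 =
    (x1 * x4 * (- x3) + 1 *: x1 ^+ 3 + 1 *: x4 ^+ 3)
    + (x2 ^+ 2 * x4 + (- 1) *: x4 ^+ 3) :> {mpoly K[4]}.
  by rewrite /form_A1A5; form_ring.
apply: (@cubesD _ _ 4 2); first by apply: nodal_cubes; try linear; nonzero.
by apply: square_cube_cubes; try linear; nonzero.
Qed.

(** This is the coefficient of [t^4] in the cube of the linear form that moves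
    on a twisted cubic; the sum over the sixth roots of unity [w] with weights
    [w^2] isolates it. *)
Lemma form_A1A4_cubes : cubes 6 (form_A1A4).
Proof.
pose p : {poly K} := Poly [:: - 1; 0; 0; 0; 0; 0; 1].
have pE : p = [:: - 1; 0; 0; 0; 0; 0; 1] :> seq K.
  by rewrite (@PolyK _ 0) //= oner_eq0.
have := twisted_cubic_cubes (m := 4) (r := 6) (p := p)
  (c := nth 0 [:: 0; 0; 0; 0; 3^-1; 0; 0; 0; 0; 0])
  (l0 := x4) (l1 := x1) (l2 := x2) (l3 := - 2^-1 *: x3).
set f := (X in cubes 6 X) => cubesf.
have -> : form_A1A4 = f.
  by rewrite /f /form_A1A4; pointwise; field; rewrite ?char0.
apply: cubesf => //; try by linear.
- by rewrite monicE lead_coefE pE.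
- by rewrite pE.
- apply: closed_separable => t.
  rewrite /p /= !cons_poly_def !derivE !hornerE => pt dpt.
  case/eqP: (char0 K 5); transitivity (t * (6 * t ^+ 5) - 6 * (t ^+ 6 - 1)); first by ring.
  have -> : t ^+ 6 - 1 = 0 by rewrite -[RHS]pt; ring.
  have -> : 6 * t ^+ 5 = 0 by rewrite -[RHS]dpt; ring.
  by ring.
by case=> [|[|[|[|k]]]] // _; rewrite !big_ord_recr big_ord0 /= pE /addn /=; ring.
Qed.

(** This form combines the coefficients of [t^0] and [t^4] on a twisted cubic.
    The sequence [-1, 0, 0, 0, 1/3, 0, ...] satisfies the recurrence of [t^6 + 3
    t^4 + 1]. *)
Lemma form_A4_cubes : cubes 6 (form_A4).
Proof.
have [a aE] : exists a : K, a = 3 by exists 3.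
pose p : {poly K} := Poly [:: 1; 0; 0; 0; a; 0; 1].
have pE : p = [:: 1; 0; 0; 0; a; 0; 1] :> seq K.
  by rewrite (@PolyK _ 0) //= oner_eq0.
have := twisted_cubic_cubes (m := 4) (r := 6) (p := p)
  (c := nth 0 [:: - 1; 0; 0; 0; 3^-1; 0; 0; 0; 0; 0])
  (l0 := - x2) (l1 := x1) (l2 := x3) (l3 := - 2^-1 *: x4).
set f := (X in cubes 6 X) => cubesf.
have -> : form_A4 = f.
  by rewrite /f /form_A4; pointwise; field; rewrite ?char0.
apply: cubesf => //; try by linear.
- by rewrite monicE lead_coefE pE.
- by rewrite pE.
- apply: closed_separable => t.
  rewrite /p /= !cons_poly_def !derivE !hornerE => pt dpt.
  have e1 : t ^+ 6 + 3 * t ^+ 4 + 1 = 0 by rewrite -[RHS]pt; ring: aE.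
  have /eqP : t ^+ 3 * (t ^+ 2 + 2) * 6 = 0 by rewrite -[RHS]dpt; ring: aE.
  rewrite mulf_eq0 (negPf (char0 K 5)) orbF mulf_eq0 expf_eq0 /= => /orP[/eqP t0|/eqP t2].
    by move/eqP: e1; rewrite t0 !expr0n mulr0 !add0r oner_eq0.
  case/eqP: (char0 K 4); rewrite -[RHS]subr0 -{1}e1.
  transitivity (t ^+ 6 + 3 * t ^+ 4 + 1 - (t ^+ 4 + t ^+ 2 - 2) * (t ^+ 2 + 2)); first by ring.
  by rewrite t2 mulr0.
by case=> [|[|[|[|k]]]] // _; rewrite !big_ord_recr big_ord0 /= pE /addn /= ?aE;
  field; rewrite ?char0.
Qed.

Lemma form_A2_cubes : cubes 6 (form_A2 0 0).
Proof.
have -> : form_A2 0 0 = x1 * x2 * (x4 + 2 *: x3)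
    + ((- 1) *: x3 ^+ 3 + (3 * 0) *: (x3 ^+ 2 * (x1 + x2))
       + (3 * - 3^-1) *: (x3 * (x1 + x2) ^+ 2) + 0 *: (x1 + x2) ^+ 3)
    :> {mpoly K[4]}.
  by rewrite /form_A2; pointwise; field; rewrite ?char0.
apply: (@cubesD _ _ 4 2); first by apply: xyz_cubes; linear.
apply: binary_cubic_cubes; try by linear.
  rewrite -subr_eq0; set e := (X in X != 0).
  have -> : e = 1 / 3 by rewrite /e; field; rewrite ?char0.
  by nonzero.
rewrite -subr_eq0; set e := (X in X != 0).
have -> : e = 4 / 27 by rewrite /e; field; rewrite ?char0.
by nonzero.
Qed.

Lemma form_2A2_cubes rho : rho != 2 -> rho != - 2 -> rho ^+ 2 != 3 ->
  cubes 6 (form_2A2 rho).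
Proof.
move=> rho2 rhoN2 rho3.
have -> : form_2A2 rho = x1 * x2 * x4
    + ((- 1) *: x3 ^+ 3 + (3 * - (rho / 3)) *: (x3 ^+ 2 * x1)
       + (3 * - 3^-1) *: (x3 * x1 ^+ 2) + 0 *: x1 ^+ 3) :> {mpoly K[4]}.
  by rewrite /form_2A2; pointwise; field; rewrite ?char0.
apply: (@cubesD _ _ 4 2); first by apply: xyz_cubes; linear.
apply: binary_cubic_cubes; try by linear.
  rewrite -subr_eq0; set e := (X in X != 0).
  have -> : e = - (rho ^+ 2 - 3) / 9 by rewrite /e; field; rewrite ?char0.
  have : rho ^+ 2 - 3 != 0 by rewrite subr_eq0.
  by move=> ?; nonzero.
rewrite -subr_eq0; set e := (X in X != 0).
have -> : e = - ((rho - 2) * (rho + 2)) / 27 by rewrite /e; field; rewrite ?char0.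
have : rho - 2 != 0 by rewrite subr_eq0.
have : rho + 2 != 0 by rewrite addr_eq0.
by move=> ? ?; nonzero.
Qed.

Lemma form_3A2_cubes : cubes 5 (form_3A2).
Proof.
have -> : form_3A2 = x4 * x1 * x2 + (- 1) *: x3 ^+ 3 :> {mpoly K[4]}.
  by rewrite /form_3A2; form_ring.
apply: (@cubesD _ _ 4 1); first by apply: xyz_cubes; linear.
by apply: (cubes_seq (s := [:: (- 1, x3)])); [linear | rewrite big_seq1].
Qed.

(** With [m = x1 + rho x2], the binary cubic [m^3 - x3^2 m] has distinct roots
    and agrees with the form modulo [x1 x2] up to a multiple of [x2^3]. *)
Lemma form_A3_cubes rho : cubes 6 (form_A3 rho).
Proof.
pose m := x1 + rho *: x2; have ml : m \is 1.-homog by rewrite /m; linear.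
have -> : form_A3 rho =
    (x2 * x1 * (x4 - (3 * rho) *: m) + (rho - rho ^+ 3) *: x2 ^+ 3)
    + (x3 ^+ 2 * (- m) + (- 1) *: (- m) ^+ 3) :> {mpoly K[4]}.
  by rewrite /form_A3 /m; form_ring.
apply: (@cubesD _ _ 4 2); first by apply: conic_secant_cubes; linear.
by apply: square_cube_cubes; try linear; rewrite ?rpredN //; nonzero.
Qed.

Lemma form_A5_cubes : cubes 6 (form_A5).
Proof.
have -> : form_A5 = (x1 * x2 * x4 + 1 *: x1 ^+ 3)
    + (x3 ^+ 2 * (- x2) + (- 1) *: (- x2) ^+ 3) :> {mpoly K[4]}.
  by rewrite /form_A5; form_ring.
apply: (@cubesD _ _ 4 2); first by apply: conic_secant_cubes; linear.
by apply: square_cube_cubes; try linear; nonzero.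
Qed.

(** The monomial [x1^3] may be shifted between [x1^2 x4] and the nodal cubic
    [x2^3 + x3^3 + x1 x2 x3], which it turns into a sum of three cubes. *)
Lemma form_D4_I_cubes : cubes 6 (form_D4_I).
Proof.
have -> : form_D4_I =
    (x2 ^+ 3 + x3 ^+ 3 + 6^-1 ^+ 3 *: x1 ^+ 3 + (6 * 6^-1) *: (x2 * x3 * x1))
    + x1 ^+ 2 * (x4 - 216^-1 *: x1) :> {mpoly K[4]}.
  by rewrite /form_D4_I; pointwise; field; rewrite ?char0.
apply: (@cubesD _ _ 3 3); first by apply: hesse_cubes; linear.
by apply: sqr_linear_cubes; linear.
Qed.

Lemma form_D4_II_cubes : cubes 5 (form_D4_II).
Proof.
have -> : form_D4_II = x1 ^+ 2 * x4 + (x2 ^+ 3 + x3 ^+ 3) :> {mpoly K[4]}.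
  by rewrite /form_D4_II; form_ring.
apply: (@cubesD _ _ 3 2); first by apply: sqr_linear_cubes; linear.
apply: (cubes_seq (s := [:: (1, x2); (1, x3)])); first by linear.
by rewrite !big_cons big_nil !scale1r addr0.
Qed.

(** Multiples of [x1^2] are absorbed by [x4]. They turn the cuspidal cubic [x1
    x3^2 + x2^2 x3] into a cubic of invariant [j = 0], which is a sum of three
    cubes. *)
Lemma form_D5_cubes : cubes 6 (form_D5).
Proof.
have -> : form_D5 = x1 ^+ 2 * (x4 - 3 *: x1 - 3 *: x3)
    + (3 *: (x1 + 3^-1 *: x3) ^+ 3 + (x2 ^+ 2 * x3 + (- 9^-1) *: x3 ^+ 3))
    :> {mpoly K[4]}.
  by rewrite /form_D5; pointwise; field; rewrite ?char0.
apply: (@cubesD _ _ 3 3); first by apply: sqr_linear_cubes; linear.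
apply: (@cubesD _ _ 1 2); last by apply: square_cube_cubes; try linear; nonzero.
by apply: (cubes_seq (s := [:: (3, x1 + 3^-1 *: x3)])); [linear | rewrite big_seq1].
Qed.

Lemma form_E6_cubes : cubes 6 (form_E6).
Proof.
have -> : form_E6 = x1 ^+ 2 * (x4 - x1)
    + (1 *: x2 ^+ 3 + (x3 ^+ 2 * x1 + 1 *: x1 ^+ 3)) :> {mpoly K[4]}.
  by rewrite /form_E6; form_ring.
apply: (@cubesD _ _ 3 3); first by apply: sqr_linear_cubes; linear.
apply: (@cubesD _ _ 1 2); last by apply: square_cube_cubes; try linear; nonzero.
by apply: (cubes_seq (s := [:: (1, x2)])); [linear | rewrite big_seq1].
Qed.

Lemma form_E6_tilde_cubes3 rho : rho ^+ 3 = 0 \/ rho ^+ 3 = - 8 ->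
  cubes 3 (form_E6_tilde rho).
Proof.
case=> [/eqP|rho3].
  rewrite expf_eq0 /= => /eqP ->.
  apply: (cubes_seq (s := [:: (1, x1); (1, x2); (1, x3)])); first by linear.
  by rewrite /form_E6_tilde; form_ring.
have -> : form_E6_tilde rho = x1 ^+ 3 + x2 ^+ 3 + (- (rho / 2)) ^+ 3 *: x3 ^+ 3
    + (6 * - (rho / 2)) *: (x1 * x2 * x3).
  have -> : (- (rho / 2)) ^+ 3 = 1.
    by rewrite exprNn expr_div_n rho3; field; rewrite ?char0.
  by rewrite /form_E6_tilde; pointwise; field; rewrite ?char0.
by apply: hesse_cubes; linear.
Qed.

(** The weights solve the linear conditions on the symmetric combination [a (x +
    y + z)^3 + b ((x + k (y + z))^3 + ...)]. *)
Lemma hesse_cubes4 rho x y z : rho != 1 -> rho != 2 ->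
  x \is 1.-homog -> y \is 1.-homog -> z \is 1.-homog ->
  cubes 4 (x ^+ 3 + y ^+ 3 + z ^+ 3 - (3 * rho) *: (x * y * z)).
Proof.
move=> rho1 rho2 xl yl zl.
have [r1 r2] : 2 - rho != 0 /\ rho - 1 != 0.
  by rewrite !subr_eq0 eq_sym.
pose k := rho / (2 - rho); pose b := (2 - rho) ^+ 3 / (8 * (rho - 1) ^+ 2).
apply: (cubes_seq (s := [:: (- (b * (k + k ^+ 2 + k ^+ 3)), x + y + z);
  (b, x + k *: (y + z)); (b, y + k *: (x + z)); (b, z + k *: (x + y))])).
  by linear.
by rewrite /b /k; pointwise; field; rewrite ?char0 r1 r2.
Qed.

(** The value [rho = 2], where the symmetric decomposition degenerates, is moved
    to another value by multiplying [x1] by a primitive cube root of unity. *)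
Lemma form_E6_tilde_cubes4 rho : rho ^+ 3 != 1 -> cubes 4 (form_E6_tilde rho).
Proof.
move=> rho3; have rho1 : rho != 1 by apply: contra rho3 => /eqP ->; rewrite expr1n.
have [->|rho2] := eqVneq rho 2; last by apply: hesse_cubes4 => //; linear.
have [w w2] : exists w : K, w ^+ 2 = - w - 1.
  exists ((- 1 + sqrtC (- 3)) / 2).
  by rewrite expr_div_n sqrrD sqrtCK; field; rewrite ?char0.
have -> : form_E6_tilde 2 = (w *: x1) ^+ 3 + x2 ^+ 3 + x3 ^+ 3
    - (3 * (2 * w ^+ 2)) *: ((w *: x1) * x2 * x3).
  by rewrite /form_E6_tilde; pointwise; ring: w2.
have w6 : (2 * w ^+ 2) ^+ 3 = 8 by ring: w2.
apply: hesse_cubes4; try by linear.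
  apply/eqP => e; case/eqP: (char0 K 6); transitivity (8 - 1 : K); first by ring.
  by rewrite -w6 e; ring.
apply/eqP => e; case/eqP: (char0 K 2).
have wE : w = - 2.
  have : 2 * (w ^+ 2 - 1) = 0 by rewrite mulrBr e; ring.
  rewrite w2 => /eqP; rewrite mulf_eq0 (negPf (char0 K 1)) /= => /eqP h.
  by rewrite -[LHS]addr0 -h; ring.
by transitivity (w ^+ 2 + w + 1); [rewrite wE; ring | rewrite w2; ring].
Qed.
End Upper.

(** * Lower bounds from singular points *)

Section Polar.
Variables (K : numClosedFieldType) (n : nat).
Local Notation cubes := (@sum_of_powers K n 3).
Implicit Types (f : {mpoly K[n]}) (x y z p q v w : 'rV[K]_n).

Lemma linear_meval f (u : 'I_n -> K) : f \is 1.-homog ->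
  f.@[u] = \sum_i u i * f@_(U_(i)).
Proof.
move=> fl; suff {1}-> : f = \sum_i f@_(U_(i)) *: 'X_i.
  by rewrite raddf_sum; apply: eq_bigr => i _; rewrite /= mevalZ mevalXU mulrC.
apply/mpolyP => m; rewrite raddf_sum /=.
have [/mdeg1P[i /eqP ->]|m1] := boolP (mdeg m == 1%N).
  rewrite (bigD1 i) //= mcoeffZ mcoeffXU eqxx mulr1 big1 ?addr0 // => j ji.
  by rewrite mcoeffZ mcoeffXU (negPf ji) mulr0.
rewrite (dhomog_nemf_coeff fl m1) big1 // => i _.
rewrite mcoeffZ mcoeffX; case: eqP => [e|_]; last by rewrite mulr0.
by rewrite -e mdeg1 in m1.
Qed.

(** The full polarization of the cubic form [f]: [polar f p p] is the gradient
    at [p], [polar f p] is the Hessian at [p] and also the polar quadric of [p],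
    each up to a constant factor. *)
Definition polar f x y z : K :=
  let F (u : 'rV[K]_n) := f.@[fun i => u 0 i] in
  F (x + y + z) - F (x + y) - F (x + z) - F (y + z) + F x + F y + F z.

Lemma polar_cubes r f : cubes r f -> exists A : 'M[K]_(n, r), forall x y z,
  polar f x y z =
    6 * \sum_j (x *m A) 0 j * (y *m A) 0 j * (z *m A) 0 j.
Proof.
move=> [l [l_lin ->]]; exists (\matrix_(i, j) (l j)@_(U_(i))) => x y z.
have F (u : 'rV[K]_n) : (\sum_(i < r) l i ^+ 3).@[fun i => u 0 i] =
    \sum_(j < r) ((u *m \matrix_(i, j) (l j)@_(U_(i))) 0 j) ^+ 3.
  rewrite raddf_sum; apply: eq_bigr => j _; rewrite /= rmorphXn /= linear_meval //.
  by congr (_ ^+ 3); rewrite mxE; apply: eq_bigr => i _; rewrite mxE.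
rewrite /polar !F mulr_sumr -!(sumrB, big_split); apply: eq_bigr => j _ /=.
by rewrite !mulmxDl ![(_ + _ : 'M__) 0 j]mxE; ring.
Qed.

(** For a cubic form: all the variables are needed in every coordinate system.
    *)
Definition concise f := forall w, (forall y z, polar f w y z = 0) -> w = 0.

Section Decomposition.
Variables (f : {mpoly K[n]}) (r : nat) (A : 'M[K]_(n, r)).
Hypothesis f_concise : concise f.
Hypothesis fA : forall x y z,
  polar f x y z = 6 * \sum_j (x *m A) 0 j * (y *m A) 0 j * (z *m A) 0 j.

Lemma concise_row_free : row_free A.
Proof.
apply: inj_row_free => w wA; apply: f_concise => y z.
by rewrite fA wA big1 ?mulr0 // => j _; rewrite mxE !mul0r.
Qed.

(** If [f] is the sum of the cubes of the [l_j], the linear form [polar f x y]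
    is [6 sum_j l_j(x) l_j(y) l_j]. *)
Lemma polar_relation x y : (forall z, polar f x y z = 0) ->
  (\row_j ((x *m A) 0 j * (y *m A) 0 j)) *m A^T = 0.
Proof.
move=> xy0; apply/rowP => i; rewrite [RHS]mxE mxE.
apply: (mulfI (char0 K 5)); rewrite mulr0 -[RHS](xy0 (delta_mx 0 i)) fA.
by congr (_ * _); apply: eq_bigr => j _; rewrite -rowE !mxE.
Qed.
End Decomposition.

Lemma concise_rank f r : concise f -> cubes r f -> (n <= r)%N.
Proof.
move=> f_concise /polar_cubes[A fA].
have := concise_row_free f_concise fA; rewrite /row_free => /eqP <-.
exact: rank_leq_col.
Qed.

(** The gradient at a singular point is a linear relation, with coefficients the
    squares [l_j(p)^2], between linear forms that span the dual space. *)
Lemma singular_rank f r p : concise f -> p != 0 ->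
  (forall z, polar f p p z = 0) -> cubes r f -> (n < r)%N.
Proof.
move=> f_concise p0 p_sing f_r; rewrite ltn_neqAle (concise_rank f_concise f_r).
rewrite andbT; apply: contra p0 => /eqP nr.
have [A fA] := polar_cubes f_r; have A_free := concise_row_free f_concise fA.
have At_free : row_free A^T by rewrite /row_free mxrank_tr (eqP A_free) nr.
have /eqP := polar_relation fA p_sing; rewrite mulmx_free_eq0 // => /eqP c0.
rewrite -(mulmx_free_eq0 _ A_free); apply/eqP/rowP => j; move/rowP/(_ j): c0.
by rewrite !mxE => /eqP; rewrite mulf_eq0 orbb => /eqP.
Qed.

(** In a decomposition of length [n + 1] the relations [c] and [d] given by the
    gradient at [p] and by the direction [v] in the kernel of the Hessian are
    proportional. A form [l_j] that vanishes at [p] but not at [v] is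
    independent of the others, so there is a vector [q], on which [l_j] is 1 and
    the others vanish, whose polar quadric is the square of [l_j]. *)
Lemma degenerate_singular_rank f r p v : concise f -> p != 0 ->
  (forall t, v != t *: p) ->
  (forall z, polar f p p z = 0) -> (forall z, polar f p v z = 0) ->
  (forall q (lam : 'cV_n),
     (forall y z, polar f q y z = 6 * ((y *m lam) 0 0 * (z *m lam) 0 0)) ->
     (p *m lam) 0 0 = 0 -> (v *m lam) 0 0 = 0) ->
  cubes r f -> (n.+1 < r)%N.
Proof.
move=> f_concise p0 v_p p_sing pv_sing no_square f_r.
rewrite ltn_neqAle (singular_rank f_concise p0 p_sing f_r) andbT.
apply/eqP => nr; have [A fA] := polar_cubes f_r.
have A_free := concise_row_free f_concise fA.
have rkA : \rank A = n by apply/eqP.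
pose c := \row_j ((p *m A) 0 j * (p *m A) 0 j).
pose d := \row_j ((p *m A) 0 j * (v *m A) 0 j).
have cA : c *m A^T = 0 := polar_relation fA p_sing.
have dA : d *m A^T = 0 := polar_relation fA pv_sing.
have c0 : c != 0.
  apply: contra p0 => /eqP/rowP c0; rewrite -(mulmx_free_eq0 _ A_free).
  apply/eqP/rowP => j; move/(_ j): c0.
  by rewrite !mxE => /eqP; rewrite mulf_eq0 orbb => /eqP.
have rkc : \rank c = 1%N by rewrite rank_rV c0.
have [t dE] : exists t, d = t *: c.
  apply/sub_rVP; apply: (@submx_trans _ _ _ _ _ _ (kermx A^T)).
    by apply/sub_kermxP.
  have c_ker : (c <= kermx A^T)%MS by apply/sub_kermxP.
  by rewrite -(mxrank_leqif_sup c_ker) rkc mxrank_ker mxrank_tr rkA -nr subSnn.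
pose v' := v - t *: p.
have v'E j : (v' *m A) 0 j = (v *m A) 0 j - t * (p *m A) 0 j.
  rewrite /v' mulmxBl -scalemxAl mxE [(- _ : 'M__) 0 j]mxE.
  by rewrite [(_ *: _ : 'M__) 0 j]mxE.
have Pv' j : (p *m A) 0 j * (v' *m A) 0 j = 0.
  move/rowP/(_ j): dE; rewrite [LHS]mxE [RHS]mxE [c 0 j]mxE v'E mulrBr => ->.
  by ring.
have v'0 : v' *m A != 0 by rewrite mulmx_free_eq0 // subr_eq0.
have /rV0Pn[j v'j] := v'0.
have pj : (p *m A) 0 j = 0.
  by move/eqP: (Pv' j); rewrite mulf_eq0 (negPf v'j) orbF => /eqP.
(* The rows of [A] span the orthogonal of [c], and [c] vanishes at [j]. *)
have [q qA] : exists q : 'rV_n, delta_mx 0 j = q *m A.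
  apply/submxP; apply: (@submx_trans _ _ _ _ _ _ (kermx c^T)).
    apply/sub_kermxP; rewrite -rowE; apply/rowP => i.
    by rewrite ord1 [LHS]mxE [LHS]mxE [LHS]mxE pj mul0r mxE.
  have A_ker : (A <= kermx c^T)%MS.
    by apply/sub_kermxP; rewrite -[A]trmxK -trmx_mul cA trmx0.
  by rewrite -(mxrank_leqif_sup A_ker) mxrank_ker mxrank_tr rkc rkA -nr subn1.
have lamE y : (y *m col j A) 0 0 = (y *m A) 0 j.
  by rewrite !mxE; apply: eq_bigr => i _; rewrite mxE.
case/eqP: v'j; rewrite v'E pj mulr0 subr0.
have := no_square q (col j A); rewrite !lamE; apply=> // y z.
rewrite !lamE fA -qA (bigD1 j) //= big1 ?addr0 => [|i ij].
  by rewrite [delta_mx _ _ _ _]mxE !eqxx mul1r.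
by rewrite [delta_mx _ _ _ _]mxE (negPf ij) andbF !mul0r.
Qed.
End Polar.

(** * Three families of singular cubic surfaces *)

Section Families.
Variable K : numClosedFieldType.
Local Notation cubes := (@sum_of_powers K 4 3).
Local Notation x1 := ('X_0 : {mpoly K[4]}).
Local Notation x2 := ('X_1 : {mpoly K[4]}).
Local Notation x3 := ('X_2 : {mpoly K[4]}).
Local Notation x4 := ('X_3 : {mpoly K[4]}).

Definition vec (a b c d : K) : 'rV[K]_4 := \row_i [:: a; b; c; d]`_i.

Lemma vecE a b c d : (vec a b c d 0 0 = a) * (vec a b c d 0 1 = b) *
  (vec a b c d 0 2 = c) * (vec a b c d 0 3 = d).
Proof. by rewrite !mxE. Qed.

Lemma vecP (x y : 'rV[K]_4) :
  x 0 0 = y 0 0 -> x 0 1 = y 0 1 -> x 0 2 = y 0 2 -> x 0 3 = y 0 3 -> x = y.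
Proof.
move=> e0 e1 e2 e3; apply/rowP => -[[|[|[|[|i]]]] lti] //.
- by rewrite (_ : Ordinal _ = 0) //; apply: val_inj.
- by rewrite (_ : Ordinal _ = 1) //; apply: val_inj.
- by rewrite (_ : Ordinal _ = 2) //; apply: val_inj.
- by rewrite (_ : Ordinal _ = 3) //; apply: val_inj.
Qed.

(** Twice the polarization of the monomial [x_i x_j]. *)
Definition sym (y z : 'rV[K]_4) i j : K := y 0 i * z 0 j + y 0 j * z 0 i.

(** Cubics with a node at [(0, 0, 0, 1)] whose tangent cone is irreducible. *)
Definition cone_form (a1 a2 a3 a4 b1 b2 b3 d1 d2 e : K) : {mpoly K[4]} :=
  x4 * (x2 ^+ 2 - x1 * x3)
  + a1 *: x1 ^+ 3 + a2 *: (x1 ^+ 2 * x2) + a3 *: (x1 * x2 ^+ 2) + a4 *: x2 ^+ 3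
  + x3 * (b1 *: x1 ^+ 2 + b2 *: (x1 * x2) + b3 *: x2 ^+ 2)
  + x3 ^+ 2 * (d1 *: x1 + d2 *: x2) + e *: x3 ^+ 3.

Lemma polar_cone a1 a2 a3 a4 b1 b2 b3 d1 d2 e (q y z : 'rV[K]_4) :
  polar (cone_form a1 a2 a3 a4 b1 b2 b3 d1 d2 e) q y z =
  (3 * a1 * q 0 0 + a2 * q 0 1 + b1 * q 0 2) * sym y z 0 0
  + (2 * a2 * q 0 0 + 2 * a3 * q 0 1 + b2 * q 0 2) * sym y z 0 1
  + (a3 * q 0 0 + 3 * a4 * q 0 1 + b3 * q 0 2 + q 0 3) * sym y z 1 1
  + (2 * b1 * q 0 0 + b2 * q 0 1 + 2 * d1 * q 0 2 - q 0 3) * sym y z 0 2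
  + (b2 * q 0 0 + 2 * b3 * q 0 1 + 2 * d2 * q 0 2) * sym y z 1 2
  + (d1 * q 0 0 + d2 * q 0 1 + 3 * e * q 0 2) * sym y z 2 2
  - q 0 2 * sym y z 0 3 + 2 * q 0 1 * sym y z 1 3 - q 0 0 * sym y z 2 3.
Proof.
have F (u : 'I_4 -> K) : (cone_form a1 a2 a3 a4 b1 b2 b3 d1 d2 e).@[u] =
    u 3 * (u 1 ^+ 2 - u 0 * u 2) + a1 * u 0 ^+ 3 + a2 * (u 0 ^+ 2 * u 1)
    + a3 * (u 0 * u 1 ^+ 2) + a4 * u 1 ^+ 3
    + u 2 * (b1 * u 0 ^+ 2 + b2 * (u 0 * u 1) + b3 * u 1 ^+ 2)
    + u 2 ^+ 2 * (d1 * u 0 + d2 * u 1) + e * u 2 ^+ 3.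
  rewrite /cone_form -!mul_mpolyC.
  by rewrite !(mevalD, mevalN, mevalM, mevalXU, mevalC, rmorphXn) /=; ring.
by rewrite /polar !F /sym !mxE; ring.
Qed.

Local Notation e1 := (vec 1 0 0 0).
Local Notation e2 := (vec 0 1 0 0).
Local Notation e3 := (vec 0 0 1 0).
Local Notation e4 := (vec 0 0 0 1).

Lemma vec_mul a b c d (lam : 'cV[K]_4) : (vec a b c d *m lam) 0 0 =
  a * lam 0 0 + b * lam 1 0 + c * lam 2 0 + d * lam 3 0.
Proof.
rewrite mxE !big_ord_recl big_ord0 addr0 !mxE /= -!addrA.
by do !congr (_ + _); congr (_ * lam _ 0); apply: val_inj.
Qed.

Lemma vec_neq0 (x : 'rV[K]_4) i : x 0 i != 0 -> x != 0.
Proof. by apply: contra => /eqP ->; rewrite mxE. Qed.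

Lemma vec_neq_scale (x y : 'rV[K]_4) i : y 0 i = 0 -> x 0 i != 0 ->
  forall t, x != t *: y.
Proof.
by move=> y0 x0 t; apply: contra x0 => /eqP ->; rewrite mxE y0 mulr0.
Qed.

Lemma cone_concise a1 a2 a3 a4 b1 b2 b3 d1 d2 e :
  concise (cone_form a1 a2 a3 a4 b1 b2 b3 d1 d2 e).
Proof.
move=> w H.
have := H e3 e4; have := H e2 e4; have := H e1 e4; have := H e2 e2.
rewrite !polar_cone /sym !vecE => h22 h14 h24 h34.
have w0 : w 0 0 = 0 by rewrite -[RHS]oppr0 -h34; ring.
have w1 : w 0 1 = 0.
  by apply: (mulfI (char0 K 1)); rewrite mulr0 -h24; ring.
have w2 : w 0 2 = 0 by rewrite -[RHS]oppr0 -h14; ring.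
have w3 : w 0 3 = 0.
  by apply: (mulfI (char0 K 1)); rewrite mulr0 -h22 w0 w1 w2; ring.
by apply: vecP; rewrite mxE.
Qed.

Lemma cone_rank5 a1 a2 a3 a4 b1 b2 b3 d1 d2 e s :
  cubes s (cone_form a1 a2 a3 a4 b1 b2 b3 d1 d2 e) -> (5 <= s)%N.
Proof.
move=> f_s.
apply: (@singular_rank _ _ _ _ e4 (@cone_concise _ _ _ _ _ _ _ _ _ _) _ _ f_s) => [|z].
  by apply: (@vec_neq0 _ 3); rewrite vecE oner_eq0.
by rewrite polar_cone /sym !vecE; ring.
Qed.

(** The point [(0, 0, 1, 0)] is singular and its tangent cone is a pair of
    planes containing the point [(0, 1, 0, b2)]. *)
Lemma cone_rank6 a1 a2 a3 a4 b1 b2 s :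
  cubes s (cone_form a1 a2 a3 a4 b1 b2 0 0 0 0) -> (6 <= s)%N.
Proof.
move=> f_s; apply: (@degenerate_singular_rank _ _ _ _ e3 (vec 0 1 0 b2)
  (@cone_concise _ _ _ _ _ _ _ _ _ _) _ _ _ _ _ f_s) => [||z|z|q lam H].
- by apply: (@vec_neq0 _ 2); rewrite vecE oner_eq0.
- by apply: (@vec_neq_scale _ _ 1); rewrite vecE ?oner_eq0.
- by rewrite polar_cone /sym !vecE; ring.
- by rewrite polar_cone /sym !vecE; ring.
have {}H y z : polar (cone_form a1 a2 a3 a4 b1 b2 0 0 0 0) q y z
    - 6 * ((y *m lam) 0 0 * (z *m lam) 0 0) = 0 by rewrite H subrr.
rewrite !vec_mul !(mul0r, mul1r, add0r, addr0) => lam2.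
have := H e3 e4; have := H e2 e4; have := H e1 e3; have := H e2 e2; have := H e4 e4.
rewrite !polar_cone /sym !vecE !vec_mul lam2 => h44 h22 h13 h24 h34.
have lam3 : lam 3 0 = 0.
  apply/eqP; rewrite -sqrf_eq0; apply/eqP.
  by apply: (mulfI (char0 K 5)); rewrite mulr0 -[RHS]oppr0 -h44; ring.
have q0 : q 0 0 = 0 by rewrite -[RHS]oppr0 -h34; ring.
have q1 : q 0 1 = 0.
  by apply: (mulfI (char0 K 1)); rewrite mulr0 -h24 lam3; ring.
have q3 : q 0 3 = 0 by rewrite -[RHS]oppr0 -h13 q0 q1; ring.
rewrite lam3 mulr0 addr0; apply/eqP; rewrite -sqrf_eq0; apply/eqP.
by apply: (mulfI (char0 K 5)); rewrite mulr0 -[RHS]oppr0 -h22 q0 q1 q3; ring.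
Qed.

(** Cubics whose tangent cone at [(0, 0, 0, 1)] is the pair of planes [x1 x2 =
    0]; the monomials divisible by [x1 x2] are absorbed by [x4]. *)
Definition triangle_form (b1 b2 b3 b4 d1 d2 d3 : K) : {mpoly K[4]} :=
  x4 * x1 * x2 + b1 *: x1 ^+ 3 + b2 *: (x1 ^+ 2 * x3) + b3 *: (x1 * x3 ^+ 2)
  + b4 *: x3 ^+ 3 + d1 *: x2 ^+ 3 + d2 *: (x2 ^+ 2 * x3) + d3 *: (x2 * x3 ^+ 2).

Lemma polar_triangle b1 b2 b3 b4 d1 d2 d3 (q y z : 'rV[K]_4) :
  polar (triangle_form b1 b2 b3 b4 d1 d2 d3) q y z =
  (3 * b1 * q 0 0 + b2 * q 0 2) * sym y z 0 0 + q 0 3 * sym y z 0 1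
  + (3 * d1 * q 0 1 + d2 * q 0 2) * sym y z 1 1
  + (2 * b2 * q 0 0 + 2 * b3 * q 0 2) * sym y z 0 2
  + (2 * d2 * q 0 1 + 2 * d3 * q 0 2) * sym y z 1 2
  + (b3 * q 0 0 + d3 * q 0 1 + 3 * b4 * q 0 2) * sym y z 2 2
  + q 0 1 * sym y z 0 3 + q 0 0 * sym y z 1 3.
Proof.
have F (u : 'I_4 -> K) : (triangle_form b1 b2 b3 b4 d1 d2 d3).@[u] =
    u 3 * u 0 * u 1 + b1 * u 0 ^+ 3 + b2 * (u 0 ^+ 2 * u 2)
    + b3 * (u 0 * u 2 ^+ 2) + b4 * u 2 ^+ 3 + d1 * u 1 ^+ 3
    + d2 * (u 1 ^+ 2 * u 2) + d3 * (u 1 * u 2 ^+ 2).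
  rewrite /triangle_form -!mul_mpolyC.
  by rewrite !(mevalD, mevalN, mevalM, mevalXU, mevalC, rmorphXn) /=; ring.
by rewrite /polar !F /sym !mxE; ring.
Qed.

Lemma triangle_concise (b1 b2 b3 b4 d1 d2 d3 : K) :
  [|| b2 != 0, b3 != 0, b4 != 0, d2 != 0 | d3 != 0] ->
  concise (triangle_form b1 b2 b3 b4 d1 d2 d3).
Proof.
move=> bd w H.
have := H e1 e4; have := H e2 e4; have := H e1 e2; have := H e1 e1.
have := H e1 e3; have := H e2 e2; have := H e2 e3; have := H e3 e3.
rewrite !polar_triangle /sym !vecE => h33 h23 h22 h13 h11 h12 h24 h14.
have w0 : w 0 0 = 0 by rewrite -h24; ring.
have w1 : w 0 1 = 0 by rewrite -h14; ring.
have w3 : w 0 3 = 0 by rewrite -h12; ring.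
apply: vecP; rewrite ?mxE //; move: h33 h23 h22 h13 h11; rewrite w0 w1.
have w2 c : c != 0 -> c * w 0 2 = 0 -> w 0 2 = 0.
  by move=> /negPf c0 /eqP; rewrite mulf_eq0 c0 => /eqP.
move=> h33 h23 h22 h13 h11.
case/or4P: bd => [b0|b0|b0|/orP[b0|b0]]; apply: (w2 _ b0); apply: (mulfI (char0 K 1));
  rewrite mulr0.
- by rewrite -h11; ring.
- by rewrite -h13; ring.
- by apply: (mulfI (char0 K 2)); rewrite mulr0 -h33; ring.
- by rewrite -h22; ring.
- by rewrite -h23; ring.
Qed.

Lemma triangle_rank5 (b1 b2 b3 b4 d1 d2 d3 : K) s :
  [|| b2 != 0, b3 != 0, b4 != 0, d2 != 0 | d3 != 0] ->
  cubes s (triangle_form b1 b2 b3 b4 d1 d2 d3) -> (5 <= s)%N.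
Proof.
move=> bd f_s.
apply: (@singular_rank _ _ _ _ e4 (triangle_concise bd) _ _ f_s) => [|z].
  by apply: (@vec_neq0 _ 3); rewrite vecE oner_eq0.
by rewrite polar_triangle /sym !vecE; ring.
Qed.

(** Only the points of the line [x1 = x2 = 0] can have a polar quadric without
    [x4]; modulo [x1 x2] such a polar quadric is a multiple of the derivative of
    the form in [x3], which is the square of a linear form involving [x3] only
    under the excluded equations. *)
Lemma triangle_rank6 (b1 b2 b3 b4 d1 d2 d3 : K) s :
  [|| b2 != 0, b3 != 0, b4 != 0, d2 != 0 | d3 != 0] ->
  (b4 != 0 -> 3 * b4 * b2 = b3 ^+ 2 -> 3 * b4 * d2 = d3 ^+ 2 -> False) ->
  cubes s (triangle_form b1 b2 b3 b4 d1 d2 d3) -> (6 <= s)%N.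
Proof.
move=> bd no_square f_s; apply: (@degenerate_singular_rank _ _ _ _ e4 e3
  (triangle_concise bd) _ _ _ _ _ f_s) => [||z|z|q lam H].
- by apply: (@vec_neq0 _ 3); rewrite vecE oner_eq0.
- by apply: (@vec_neq_scale _ _ 2); rewrite vecE ?oner_eq0.
- by rewrite polar_triangle /sym !vecE; ring.
- by rewrite polar_triangle /sym !vecE; ring.
have {}H y z : polar (triangle_form b1 b2 b3 b4 d1 d2 d3) q y z
    - 6 * ((y *m lam) 0 0 * (z *m lam) 0 0) = 0 by rewrite H subrr.
rewrite !vec_mul !(mul0r, mul1r, add0r, addr0) => lam3.
have := H e4 e1; have := H e4 e2; have := H e3 e3; have := H e1 e3.
have := H e1 e1; have := H e2 e3; have := H e2 e2.
rewrite !polar_triangle /sym !vecE !vec_mul lam3 => h22 h23 h11 h13 h33 h42 h41.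
have q1 : q 0 1 = 0 by rewrite -h41; ring.
have q0 : q 0 0 = 0 by rewrite -h42; ring.
have l22 : b4 * q 0 2 = lam 2 0 ^+ 2.
  apply/eqP; rewrite -subr_eq0; apply/eqP; apply: (mulfI (char0 K 5)).
  by rewrite mulr0 -h33 q0 q1; ring.
have l02 : b3 * q 0 2 = 3 * (lam 0 0 * lam 2 0).
  apply/eqP; rewrite -subr_eq0; apply/eqP; apply: (mulfI (char0 K 1)).
  by rewrite mulr0 -h13 q0 q1; ring.
have l00 : b2 * q 0 2 = 3 * lam 0 0 ^+ 2.
  apply/eqP; rewrite -subr_eq0; apply/eqP; apply: (mulfI (char0 K 1)).
  by rewrite mulr0 -h11 q0 q1; ring.
have l12 : d3 * q 0 2 = 3 * (lam 1 0 * lam 2 0).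
  apply/eqP; rewrite -subr_eq0; apply/eqP; apply: (mulfI (char0 K 1)).
  by rewrite mulr0 -h23 q0 q1; ring.
have l11 : d2 * q 0 2 = 3 * lam 1 0 ^+ 2.
  apply/eqP; rewrite -subr_eq0; apply/eqP; apply: (mulfI (char0 K 1)).
  by rewrite mulr0 -h22 q0 q1; ring.
have [//|lam2] := eqVneq (lam 2 0) 0.
have := expf_neq0 2 lam2; rewrite -l22 mulf_eq0 negb_or => /andP[b40 q20].
have q22 := mulf_neq0 q20 q20.
case: (no_square b40); apply: (mulIf q22).
  transitivity (3 * (b4 * q 0 2) * (b2 * q 0 2)); first by ring.
  transitivity ((b3 * q 0 2) ^+ 2); last by ring.
  by rewrite l22 l00 l02; ring.
transitivity (3 * (b4 * q 0 2) * (d2 * q 0 2)); first by ring.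
transitivity ((d3 * q 0 2) ^+ 2); last by ring.
by rewrite l22 l11 l12; ring.
Qed.

(** Cubics whose tangent cone at [(0, 0, 0, 1)] is the double plane [x1^2 = 0];
    the monomials divisible by [x1^2] are absorbed by [x4]. *)
Definition tangent_form (u v w c0 c1 c2 c3 : K) : {mpoly K[4]} :=
  x4 * x1 ^+ 2 + x1 * (u *: x2 ^+ 2 + v *: (x2 * x3) + w *: x3 ^+ 2)
  + c0 *: x2 ^+ 3 + c1 *: (x2 ^+ 2 * x3) + c2 *: (x2 * x3 ^+ 2) + c3 *: x3 ^+ 3.

Lemma polar_tangent u v w c0 c1 c2 c3 (q y z : 'rV[K]_4) :
  polar (tangent_form u v w c0 c1 c2 c3) q y z =
  q 0 3 * sym y z 0 0 + (2 * u * q 0 1 + v * q 0 2) * sym y z 0 1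
  + (v * q 0 1 + 2 * w * q 0 2) * sym y z 0 2 + 2 * q 0 0 * sym y z 0 3
  + (u * q 0 0 + 3 * c0 * q 0 1 + c1 * q 0 2) * sym y z 1 1
  + (v * q 0 0 + 2 * c1 * q 0 1 + 2 * c2 * q 0 2) * sym y z 1 2
  + (w * q 0 0 + c2 * q 0 1 + 3 * c3 * q 0 2) * sym y z 2 2.
Proof.
have F (t : 'I_4 -> K) : (tangent_form u v w c0 c1 c2 c3).@[t] =
    t 3 * t 0 ^+ 2 + t 0 * (u * t 1 ^+ 2 + v * (t 1 * t 2) + w * t 2 ^+ 2)
    + c0 * t 1 ^+ 3 + c1 * (t 1 ^+ 2 * t 2) + c2 * (t 1 * t 2 ^+ 2)
    + c3 * t 2 ^+ 3.
  rewrite /tangent_form -!mul_mpolyC.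
  by rewrite !(mevalD, mevalN, mevalM, mevalXU, mevalC, rmorphXn) /=; ring.
by rewrite /polar !F /sym !mxE; ring.
Qed.

Lemma tangent_concise u v w c0 c1 c2 c3 :
  (forall a b, 2 * u * a + v * b = 0 -> v * a + 2 * w * b = 0 ->
    3 * c0 * a + c1 * b = 0 -> 2 * c1 * a + 2 * c2 * b = 0 ->
    c2 * a + 3 * c3 * b = 0 -> a = 0 /\ b = 0) ->
  concise (tangent_form u v w c0 c1 c2 c3).
Proof.
move=> binary_concise q H.
have := H e1 e4; have := H e1 e1; have := H e1 e2; have := H e1 e3.
have := H e2 e2; have := H e2 e3; have := H e3 e3.
rewrite !polar_tangent /sym !vecE => h33 h23 h22 h13 h12 h11 h14.
have q0 : q 0 0 = 0 by apply: (mulfI (char0 K 1)); rewrite mulr0 -h14; ring.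
have q3 : q 0 3 = 0 by apply: (mulfI (char0 K 1)); rewrite mulr0 -h11; ring.
have [|||||q1 q2] := binary_concise (q 0 1) (q 0 2).
- by rewrite -h12; ring.
- by rewrite -h13; ring.
- by apply: (mulfI (char0 K 1)); rewrite mulr0 -h22 q0; ring.
- by rewrite -h23 q0; ring.
- by apply: (mulfI (char0 K 1)); rewrite mulr0 -h33 q0; ring.
by apply: vecP; rewrite mxE.
Qed.

Lemma tangent_rank5 u v w c0 c1 c2 c3 s :
  concise (tangent_form u v w c0 c1 c2 c3) ->
  cubes s (tangent_form u v w c0 c1 c2 c3) -> (5 <= s)%N.
Proof.
move=> f_concise f_s; apply: (@singular_rank _ _ _ _ e4 f_concise _ _ f_s) => [|z].
  by apply: (@vec_neq0 _ 3); rewrite vecE oner_eq0.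
by rewrite polar_tangent /sym !vecE; ring.
Qed.

(** The Hessian at the singular point kills every vector [(0, a, b, 0)], so [a]
    and [b] can be chosen to suit the form. *)
Lemma tangent_rank6 (u v w c0 c1 c2 c3 a b : K) s :
  concise (tangent_form u v w c0 c1 c2 c3) -> (a != 0) || (b != 0) ->
  (forall q1 q2 (l0 l1 l2 : K), 2 * u * q1 + v * q2 = 6 * (l0 * l1) ->
    v * q1 + 2 * w * q2 = 6 * (l0 * l2) -> 3 * c0 * q1 + c1 * q2 = 3 * l1 ^+ 2 ->
    c1 * q1 + c2 * q2 = 3 * (l1 * l2) -> c2 * q1 + 3 * c3 * q2 = 3 * l2 ^+ 2 ->
    a * l1 + b * l2 = 0) ->
  cubes s (tangent_form u v w c0 c1 c2 c3) -> (6 <= s)%N.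
Proof.
move=> f_concise ab no_square f_s.
apply: (@degenerate_singular_rank _ _ _ _ e4 (vec 0 a b 0)
  f_concise _ _ _ _ _ f_s) => [||z|z|q lam H].
- by apply: (@vec_neq0 _ 3); rewrite vecE oner_eq0.
- by case/orP: ab => ab; [apply: (@vec_neq_scale _ _ 1) | apply: (@vec_neq_scale _ _ 2)];
    rewrite vecE.
- by rewrite polar_tangent /sym !vecE; ring.
- by rewrite polar_tangent /sym !vecE; ring.
have {}H y z : polar (tangent_form u v w c0 c1 c2 c3) q y z
    - 6 * ((y *m lam) 0 0 * (z *m lam) 0 0) = 0 by rewrite H subrr.
rewrite !vec_mul !(mul0r, mul1r, add0r, addr0) => lam3.
have := H e4 e1; have := H e1 e2; have := H e1 e3.
have := H e2 e2; have := H e2 e3; have := H e3 e3.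
rewrite !polar_tangent /sym !vecE !vec_mul lam3 => h33 h23 h22 h13 h12 h41.
have q0 : q 0 0 = 0 by apply: (mulfI (char0 K 1)); rewrite mulr0 -h41; ring.
apply: (no_square (q 0 1) (q 0 2) (lam 0 0)); apply/eqP; rewrite -subr_eq0;
  apply/eqP.
- by rewrite -h12; ring.
- by rewrite -h13; ring.
- by apply: (mulfI (char0 K 1)); rewrite mulr0 -h22 q0; ring.
- by apply: (mulfI (char0 K 1)); rewrite mulr0 -h23 q0; ring.
- by apply: (mulfI (char0 K 1)); rewrite mulr0 -h33 q0; ring.
Qed.
End Families.

(** * Ranks of the normal forms *)

Section Ranks.
Variable K : numClosedFieldType.
Local Notation cubes := (@sum_of_powers K 4 3).
Local Notation x4 := ('X_3 : {mpoly K[4]}).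
Implicit Types (rho : K) (s : nat).

Lemma cone_has_rank5 (f : {mpoly K[4]}) a1 a2 a3 a4 b1 b2 b3 d1 d2 e :
  f = cone_form a1 a2 a3 a4 b1 b2 b3 d1 d2 e -> cubes 5 f -> has_rank 3 f 5.
Proof. by move=> ->; split=> // s; apply: cone_rank5. Qed.

Lemma cone_has_rank6 (f : {mpoly K[4]}) a1 a2 a3 a4 b1 b2 :
  f = cone_form a1 a2 a3 a4 b1 b2 0 0 0 0 -> cubes 6 f -> has_rank 3 f 6.
Proof. by move=> ->; split=> // s; apply: cone_rank6. Qed.

Lemma triangle_has_rank6 (f : {mpoly K[4]}) b1 b2 b3 b4 d1 d2 d3 :
  f = triangle_form b1 b2 b3 b4 d1 d2 d3 ->
  [|| b2 != 0, b3 != 0, b4 != 0, d2 != 0 | d3 != 0] ->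
  (b4 != 0 -> 3 * b4 * b2 = b3 ^+ 2 -> 3 * b4 * d2 = d3 ^+ 2 -> False) ->
  cubes 6 f -> has_rank 3 f 6.
Proof. by move=> -> bd no_square; split=> // s; apply: triangle_rank6. Qed.

Lemma form_A1_rank (r1 r2 r3 : K) : cubes 5 (form_A1 r1 r2 r3) ->
  has_rank 3 (form_A1 r1 r2 r3) 5.
Proof.
apply: (@cone_has_rank5 _ 0 1 (- (1 + r1 + r2 + r3)) ((1 + r1) * (r2 + r3)) 0
  (r1 + r2 * r3) (- ((1 + r1) * r2 * r3 + r1 * (r2 + r3))) 0 (r1 * r2 * r3) 0).
by rewrite /form_A1 /cone_form; form_ring.
Qed.

Lemma form_3A1_rank rho : rho != 0 -> rho ^+ 2 != 14 / 9 * rho - 1 ->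
  has_rank 3 (form_3A1 rho) 5.
Proof.
move=> rho0 rhoN.
apply: (@cone_has_rank5 _ 0 0 1 (- (1 + rho)) 0 0 rho 0 0 0).
  by rewrite /form_3A1 /cone_form; form_ring.
exact: form_3A1_cubes.
Qed.

Lemma form_4A1_rank : has_rank 3 (form_4A1 : {mpoly K[4]}) 5.
Proof.
apply: (@cone_has_rank5 _ 0 0 1 (- 2) 0 0 1 0 0 0 _ (form_4A1_cubes K)).
by rewrite /form_4A1 /cone_form; form_ring.
Qed.

Lemma form_A1A2_rank rho : rho != 0 -> rho ^+ 2 = rho - 1 ->
  has_rank 3 (form_A1A2 rho) 6.
Proof.
move=> rho0 rho2.
apply: (@cone_has_rank6 _ 0 1 (- (1 + rho)) 0 0 rho).
  by rewrite /form_A1A2 /cone_form; form_ring.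
exact: form_A1A2_cubes.
Qed.

Lemma form_2A1A2_rank : has_rank 3 (form_2A1A2 : {mpoly K[4]}) 6.
Proof.
apply: (@cone_has_rank6 _ 0 0 1 (- 1) 0 0 _ (form_2A1A2_cubes K)).
by rewrite /form_2A1A2 /cone_form; form_ring.
Qed.

Lemma form_A1_2A2_rank : has_rank 3 (form_A1_2A2 : {mpoly K[4]}) 6.
Proof.
apply: (@cone_has_rank6 _ 0 0 0 1 0 0 _ (form_A1_2A2_cubes K)).
by rewrite /form_A1_2A2 /cone_form; form_ring.
Qed.

Lemma form_A1A3_rank : has_rank 3 (form_A1A3 : {mpoly K[4]}) 6.
Proof.
apply: (@cone_has_rank6 _ 0 1 (- 1) 0 0 0 _ (form_A1A3_cubes K)).
by rewrite /form_A1A3 /cone_form; form_ring.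
Qed.

Lemma form_2A1A3_rank : has_rank 3 (form_2A1A3 : {mpoly K[4]}) 6.
Proof.
apply: (@cone_has_rank6 _ 0 0 1 0 0 0 _ (form_2A1A3_cubes K)).
by rewrite /form_2A1A3 /cone_form; form_ring.
Qed.

Lemma form_A1A4_rank : has_rank 3 (form_A1A4 : {mpoly K[4]}) 6.
Proof.
apply: (@cone_has_rank6 _ 0 1 0 0 0 0 _ (form_A1A4_cubes K)).
by rewrite /form_A1A4 /cone_form; form_ring.
Qed.

Lemma form_A1A5_rank : has_rank 3 (form_A1A5 : {mpoly K[4]}) 6.
Proof.
apply: (@cone_has_rank6 _ 1 0 0 0 0 0 _ (form_A1A5_cubes K)).
by rewrite /form_A1A5 /cone_form; form_ring.
Qed.

Lemma form_A2_rank : has_rank 3 (form_A2 0 0 : {mpoly K[4]}) 6.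
Proof.
apply: (@triangle_has_rank6 _ 0 (- 1) 0 (- 1) 0 (- 1) 0 _ _ _ (form_A2_cubes K)).
- by rewrite /form_A2 /triangle_form; form_ring.
- by rewrite oppr_eq0 oner_eq0.
move=> _ e _; case/eqP: (char0 K 2).
by transitivity (3 * -1 * -1 : K); [ring | rewrite e expr0n].
Qed.

Lemma form_2A2_rank rho : rho != 2 -> rho != - 2 -> rho ^+ 2 != 3 ->
  has_rank 3 (form_2A2 rho) 6.
Proof.
move=> rho2 rhoN2 rho3.
apply: (@triangle_has_rank6 _ 0 (- 1) (- rho) (- 1) 0 0 0).
- by rewrite /form_2A2 /triangle_form; form_ring.
- by rewrite oppr_eq0 oner_eq0.
- move=> _ e _; case/eqP: rho3.
  by transitivity ((- rho) ^+ 2); [ring | rewrite -e; ring].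
exact: form_2A2_cubes.
Qed.

Lemma form_3A2_rank : has_rank 3 (form_3A2 : {mpoly K[4]}) 5.
Proof.
split; first exact: form_3A2_cubes.
have -> : form_3A2 = triangle_form 0 0 0 (- 1) 0 0 0 :> {mpoly K[4]}.
  by rewrite /form_3A2 /triangle_form; form_ring.
by move=> s; apply: triangle_rank5; rewrite oppr_eq0 oner_eq0 !orbT.
Qed.

Lemma form_A3_rank rho : has_rank 3 (form_A3 rho) 6.
Proof.
apply: (@triangle_has_rank6 _ 1 0 (- 1) 0 rho 0 (- rho) _ _ _ (form_A3_cubes rho)).
- by rewrite /form_A3 /triangle_form; form_ring.
- by rewrite oppr_eq0 oner_eq0 orbT.
by rewrite eqxx.
Qed.

Lemma form_A4_rank : has_rank 3 (form_A4 : {mpoly K[4]}) 6.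
Proof.
apply: (@triangle_has_rank6 _ 0 1 0 0 1 0 (- 1) _ _ _ (form_A4_cubes K)).
- by rewrite /form_A4 /triangle_form; form_ring.
- by rewrite oner_eq0.
by rewrite eqxx.
Qed.

Lemma form_A5_rank : has_rank 3 (form_A5 : {mpoly K[4]}) 6.
Proof.
apply: (@triangle_has_rank6 _ 1 0 0 0 1 0 (- 1) _ _ _ (form_A5_cubes K)).
- by rewrite /form_A5 /triangle_form; form_ring.
- by rewrite oppr_eq0 oner_eq0 !orbT.
by rewrite eqxx.
Qed.

Let cancel3 (a b : K) : 3 * a = b -> b = 0 -> a = 0.
Proof. by move=> <- /eqP; rewrite mulf_eq0 (negPf (char0 K 2)) => /eqP. Qed.

Lemma form_D4_I_rank : has_rank 3 (form_D4_I : {mpoly K[4]}) 6.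
Proof.
split; first exact: form_D4_I_cubes.
have -> : form_D4_I = tangent_form 0 1 0 1 0 0 1 :> {mpoly K[4]}.
  by rewrite /form_D4_I /tangent_form; form_ring.
move=> s; apply: (@tangent_rank6 _ _ _ _ _ _ _ _ 1 0).
- by apply: tangent_concise => a b; rewrite !(mulr0, mul0r, add0r, addr0, mul1r, mulr1).
- by rewrite oner_eq0.
move=> q1 q2 l0 l1 l2; rewrite !(mulr0, mul0r, add0r, addr0, mul1r, mulr1).
move=> q2E q1E l11 l12 l22; apply/eqP; apply/negPn/negP => l1N.
have l2_0 : l2 = 0.
  have /eqP : 3 * (l1 * l2) = 0 by [].
  by rewrite !mulf_eq0 (negPf (char0 K 2)) (negPf l1N) => /eqP.
move: l11; rewrite q1E l2_0 !mulr0 => /esym/eqP.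
by rewrite !mulf_eq0 (negPf (char0 K 2)) (negPf l1N).
Qed.

Lemma form_D4_II_rank : has_rank 3 (form_D4_II : {mpoly K[4]}) 5.
Proof.
split; first exact: form_D4_II_cubes.
have -> : form_D4_II = tangent_form 0 0 0 1 0 0 1 :> {mpoly K[4]}.
  by rewrite /form_D4_II /tangent_form; form_ring.
move=> s; apply: tangent_rank5; apply: tangent_concise => a b.
rewrite !(mulr0, mul0r, add0r, addr0, mul1r, mulr1) => _ _ a0 _ b0.
by split; [apply: cancel3 a0 _ | apply: cancel3 b0 _].
Qed.

Lemma form_D5_rank : has_rank 3 (form_D5 : {mpoly K[4]}) 6.
Proof.
split; first exact: form_D5_cubes.
have -> : form_D5 = tangent_form 0 0 1 0 1 0 0 :> {mpoly K[4]}.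
  by rewrite /form_D5 /tangent_form; form_ring.
move=> s; apply: (@tangent_rank6 _ _ _ _ _ _ _ _ 1 0).
- apply: tangent_concise => a b.
  rewrite !(mulr0, mul0r, add0r, addr0, mul1r, mulr1) => _ _ -> /eqP.
  by rewrite mulf_eq0 (negPf (char0 K 1)) => /eqP.
- by rewrite oner_eq0.
move=> q1 q2 l0 l1 l2; rewrite !(mulr0, mul0r, add0r, addr0, mul1r, mulr1).
move=> _ q2E l11 _ l22; have l2_0 : l2 = 0.
  by apply/eqP; rewrite -sqrf_eq0; apply/eqP; apply: cancel3 (esym l22) _.
move: q2E; rewrite l2_0 !mulr0 => /eqP; rewrite mulf_eq0 (negPf (char0 K 1)) => /eqP q2_0.
by apply/eqP; rewrite -sqrf_eq0; apply/eqP; apply: cancel3 (esym l11) q2_0.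
Qed.

Lemma form_E6_rank : has_rank 3 (form_E6 : {mpoly K[4]}) 6.
Proof.
split; first exact: form_E6_cubes.
have -> : form_E6 = tangent_form 0 0 1 1 0 0 0 :> {mpoly K[4]}.
  by rewrite /form_E6 /tangent_form; form_ring.
move=> s; apply: (@tangent_rank6 _ _ _ _ _ _ _ _ 0 1).
- apply: tangent_concise => a b.
  rewrite !(mulr0, mul0r, add0r, addr0, mul1r, mulr1) => _ /eqP.
  rewrite mulf_eq0 (negPf (char0 K 1)) => /eqP b0 a0 _ _.
  by split=> //; apply: cancel3 a0 _.
- by rewrite oner_eq0 orbT.
move=> q1 q2 l0 l1 l2; rewrite !(mulr0, mul0r, add0r, addr0, mul1r, mulr1).
move=> _ _ _ _ l22.
by apply/eqP; rewrite -sqrf_eq0; apply/eqP; apply: cancel3 (esym l22) _.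
Qed.
End Ranks.

(** * Plane cubics of the Hesse pencil *)

Section PlaneCubic.
Variable K : numClosedFieldType.
Local Notation cubes := (@sum_of_powers K 4 3).
Local Notation x4 := ('X_3 : {mpoly K[4]}).
Implicit Types (rho : K) (s : nat).
Local Notation e1 := (vec (1 : K) 0 0 0).
Local Notation e2 := (vec (0 : K) 1 0 0).
Local Notation e3 := (vec (0 : K) 0 1 0).
Local Notation e4 := (vec (0 : K) 0 0 1).

(** If the number of cubes equals the number of variables, the linear forms are
    a basis, and the square of each of them is a polar quadric. *)
Lemma minimal_rank_square n (f : {mpoly K[n]}) (v : 'rV_n) :
  concise f -> sum_of_powers 3 n f -> v != 0 ->
  exists q (lam : 'cV_n), (v *m lam) 0 0 != 0 /\
    forall y z, polar f q y z = 6 * ((y *m lam) 0 0 * (z *m lam) 0 0).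
Proof.
move=> f_concise /polar_cubes[A fA] v0.
have A_free := concise_row_free f_concise fA.
have A_unit : A \in unitmx by rewrite -row_free_unit.
have /rV0Pn[j vj] : v *m A != 0 by rewrite mulmx_free_eq0.
have lamE y : (y *m col j A) 0 0 = (y *m A) 0 j.
  by rewrite !mxE; apply: eq_bigr => i _; rewrite mxE.
exists (delta_mx 0 j *m invmx A), (col j A); split=> [|y z]; first by rewrite lamE.
rewrite !lamE fA mulmxKV // (bigD1 j) //= big1 ?addr0 => [|i ij].
  by rewrite [delta_mx _ _ _ _]mxE !eqxx mul1r.
by rewrite [delta_mx _ _ _ _]mxE (negPf ij) andbF !mul0r.
Qed.

Lemma polar_cone_hesse rho (q y z : 'rV[K]_4) :
  polar (form_E6_tilde rho + x4 ^+ 3) q y z =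
  3 * q 0 0 * sym y z 0 0 + 3 * q 0 1 * sym y z 1 1 + 3 * q 0 2 * sym y z 2 2
  + 3 * q 0 3 * sym y z 3 3 - 3 * rho *
    (q 0 0 * sym y z 1 2 + q 0 1 * sym y z 0 2 + q 0 2 * sym y z 0 1).
Proof.
have F (u : 'I_4 -> K) : (form_E6_tilde rho + x4 ^+ 3).@[u] =
    u 0 ^+ 3 + u 1 ^+ 3 + u 2 ^+ 3 - 3 * rho * (u 0 * u 1 * u 2) + u 3 ^+ 3.
  rewrite /form_E6_tilde -!mul_mpolyC.
  by rewrite !(mevalD, mevalN, mevalM, mevalXU, mevalC, rmorphXn) /=; ring.
by rewrite /polar !F /sym !mxE; ring.
Qed.

Lemma cone_hesse_concise rho : concise (form_E6_tilde rho + x4 ^+ 3).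
Proof.
move=> w H.
have := H e1 e1; have := H e2 e2; have := H e3 e3; have := H e4 e4.
rewrite !polar_cone_hesse /sym !vecE => h44 h33 h22 h11.
by apply: vecP; apply: (mulfI (char0 K 5)); rewrite [in RHS]mxE mulr0;
  [rewrite -h11 | rewrite -h22 | rewrite -h33 | rewrite -h44]; ring.
Qed.

Lemma cone_hesse_cubes rho s :
  cubes s (form_E6_tilde rho) -> cubes s.+1 (form_E6_tilde rho + x4 ^+ 3).
Proof.
move=> f_s; rewrite -[s.+1]addn1; apply: cubesD f_s _.
apply: (cubes_seq (s := [:: (1, x4)])); first by linear.
by rewrite big_seq1 scale1r.
Qed.

Lemma form_E6_tilde_ge3 rho s : cubes s (form_E6_tilde rho) -> (3 <= s)%N.
Proof. by move=> /cone_hesse_cubes/(concise_rank (@cone_hesse_concise rho)). Qed.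

(** Adding [x4^3] gives a concise cubic in four variables. One of the squares
    provided by [minimal_rank_square] involves [x1]; comparing coefficients with
    the polar quadrics of the pencil gives [rho a^2 = - 2 b c] and its cyclic
    permutations, hence [rho^3 = - 8] by multiplication unless [rho = 0]. *)
Lemma form_E6_tilde_rank3 rho : cubes 3 (form_E6_tilde rho) ->
  rho ^+ 3 = 0 \/ rho ^+ 3 = - 8.
Proof.
move=> /cone_hesse_cubes f4.
have e10 : e1 != 0 by apply: (@vec_neq0 _ _ 0); rewrite vecE oner_eq0.
have [q [lam [l0 H]]] := minimal_rank_square (@cone_hesse_concise rho) f4 e10.
have {}H y z : polar (form_E6_tilde rho + x4 ^+ 3) q y z
    - 6 * ((y *m lam) 0 0 * (z *m lam) 0 0) = 0 by rewrite H subrr.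
move: l0; rewrite !vec_mul !(mul0r, mul1r, add0r, addr0).
have := H e1 e1; have := H e2 e2; have := H e3 e3.
have := H e2 e3; have := H e1 e3; have := H e1 e2.
rewrite !polar_cone_hesse /sym !vecE !vec_mul.
move: (lam 0 0) (lam 1 0) (lam 2 0) (lam 3 0) => a b c d h12 h13 h23 h33 h22 h11 a0.
have six (u : K) : 6 * u = 0 -> u = 0.
  by move/eqP; rewrite mulf_eq0 (negPf (char0 K 5)) => /eqP.
have qa : q 0 0 = a ^+ 2.
  by apply/eqP; rewrite -subr_eq0; apply/eqP/six; rewrite -h11; ring.
have qb : q 0 1 = b ^+ 2.
  by apply/eqP; rewrite -subr_eq0; apply/eqP/six; rewrite -h22; ring.
have qc : q 0 2 = c ^+ 2.
  by apply/eqP; rewrite -subr_eq0; apply/eqP/six; rewrite -h33; ring.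
have three (u : K) : - 3 * u = 0 -> u = 0.
  by move/eqP; rewrite mulf_eq0 oppr_eq0 (negPf (char0 K 2)) => /eqP.
have bc : rho * a ^+ 2 = - (2 * (b * c)).
  apply/eqP; rewrite -subr_eq0; apply/eqP/three; rewrite -h23 qa qb qc; ring.
have ac : rho * b ^+ 2 = - (2 * (a * c)).
  apply/eqP; rewrite -subr_eq0; apply/eqP/three; rewrite -h13 qa qb qc; ring.
have ab : rho * c ^+ 2 = - (2 * (a * b)).
  apply/eqP; rewrite -subr_eq0; apply/eqP/three; rewrite -h12 qa qb qc; ring.
have [rho0|rho0] := eqVneq rho 0; [left | right].
  by rewrite rho0 expr0n.
have : b * c != 0.
  have : rho * a ^+ 2 != 0 by rewrite mulf_neq0 ?expf_neq0.
  by rewrite bc oppr_eq0 mulf_eq0 (negPf (char0 K 1)).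
rewrite mulf_eq0 negb_or => /andP[b0 c0].
have abc : (a * b * c) ^+ 2 != 0 by rewrite expf_neq0 ?mulf_neq0.
apply: (mulIf abc).
transitivity ((rho * a ^+ 2) * (rho * b ^+ 2) * (rho * c ^+ 2)); first by ring.
by rewrite bc ac ab; ring.
Qed.
End PlaneCubic.

(** * Generic parameters *)

Section Generic.
Variable K : numClosedFieldType.

Lemma pos_neq_neg i j : (i.+1%:R : K) != - j%:R.
Proof. by rewrite -subr_eq0 opprK -natrD pnatr_eq0. Qed.

Lemma generically_neq0 n (U P : ('I_n -> K) -> Prop) (p : {mpoly K[n]}) v :
  U v -> p.@[v] != 0 -> (forall v, p.@[v] != 0 -> P v) -> generically U P.
Proof.
move=> Uv pv Pp; exists (fun v => p.@[v] = 0); split.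
- exists (fun q => q = p) => u; split=> [pu _ ->//|]; exact.
- by exists v; split=> //; apply/eqP.
by move=> u _ pu; apply: Pp; apply/eqP.
Qed.

Lemma admissible_nth (s : seq K) : 
  all (fun a => (a != 0) && (a != 1)) s -> uniq s ->
  admissible (fun i : 'I_(size s) => s`_i).
Proof.
move=> /allP s01 s_uniq; split=> [i|i j /eqP].
  by apply/andP; apply: s01; apply: mem_nth.
by rewrite nth_uniq // => /eqP/val_inj.
Qed.

Lemma form_A1_example : has_rank 3 (form_A1 (- 1 : K) 2 (- 2)) 5.
Proof.
apply: form_A1_rank; apply: form_A1_cubes (separable_A1_example erefl).
by field; rewrite ?char0.
Qed.

Lemma form_2A1_example : has_rank 3 (form_2A1 (- 1 : K) 2) 5.
Proof.
rewrite form_2A1E; apply: form_A1_rank.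
by apply: form_A1_cubes (separable_2A1_example erefl); field; rewrite ?char0.
Qed.

Lemma form_A1_generic : generically (@admissible K 3)
  (fun v => has_rank 3 (form_A1 (v 0) (v 1) (v 2)) 5).
Proof.
have n12 := pos_neq_neg 1 1; have n21 := pos_neq_neg 0 2.
have n22 := pos_neq_neg 1 2; have n11 := pos_neq_neg 0 1.
have d21 : (2 : K) != 1 by rewrite -[1]/(1%:R) eqr_nat.
have d12 : (- 1 : K) != - 2 by rewrite eqr_opp eq_sym.
have adm : admissible (fun i : 'I_3 => [:: - 1; 2; - 2 : K]`_i).
  apply: (@admissible_nth [:: - 1; 2; - 2]) => /=.
    by rewrite !oppr_eq0 !char0 oner_eq0 d21 ![- _ == _]eq_sym n11 n21.
  by rewrite !inE !negb_or [-1 == 2]eq_sym n12 d12 n22.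
apply: (generically_neq0 (p := A1_discriminant 'X_0 'X_1 'X_2) adm).
  by rewrite A1_discriminant_neq0 !mevalXU; apply: separable_A1_example.
by move=> v /A1_discriminant_cubes; rewrite !mevalXU; apply: form_A1_rank.
Qed.

Lemma form_2A1_generic : generically (@admissible K 2)
  (fun v => has_rank 3 (form_2A1 (v 0) (v 1)) 5).
Proof.
have n12 := pos_neq_neg 1 1; have n11 := pos_neq_neg 0 1.
have d21 : (2 : K) != 1 by rewrite -[1]/(1%:R) eqr_nat.
have adm : admissible (fun i : 'I_2 => [:: - 1; 2 : K]`_i).
  apply: (@admissible_nth [:: - 1; 2]) => /=.
    by rewrite !oppr_eq0 !char0 oner_eq0 d21 ![- _ == _]eq_sym n11.
  by rewrite !inE [-1 == 2]eq_sym n12.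
apply: (generically_neq0 (p := A1_discriminant 'X_0 'X_1 0) adm).
  by rewrite A1_discriminant_neq0 !mevalXU meval0; apply: separable_2A1_example.
move=> v /A1_discriminant_cubes; rewrite !mevalXU meval0 form_2A1E.
exact: form_A1_rank.
Qed.

(** The two parameters are the primitive sixth roots of unity. *)
Lemma equianharmonic_parameter (rho : K) :
  rho = (1 + sqrtC 3 * 'i) / 2 \/ rho = (1 - sqrtC 3 * 'i) / 2 ->
  rho ^+ 2 = rho - 1.
Proof.
have s2 := sqrtCK (3 : K); have i2 := sqrCi K.
move: (sqrtC 3) ('i : K) s2 i2 => s i s2 i2.
by case=> ->; field: s2 i2; rewrite ?char0.
Qed.
End Generic.

Theorem mainTheorem1 (R : realType) :
  (* A1 *)
  (generically (@admissible R[i] 3)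
     (fun v => has_rank 3 (form_A1 (v 0) (v 1) (v 2)) 5)
   /\ has_rank 3 (form_A1 (-1 : R[i]) 2 (-2)) 5) /\
  (* 2A1 *)
  (generically (@admissible R[i] 2)
     (fun v => has_rank 3 (form_2A1 (v 0) (v 1)) 5)
   /\ has_rank 3 (form_2A1 (-1 : R[i]) 2) 5) /\
  (* 3A1 *)
  (forall rho : R[i], rho != 0 -> rho != 1 ->
     rho ^+ 2 != 14 / 9 * rho - 1 -> has_rank 3 (form_3A1 rho) 5) /\
  (* 4A1 *)
  has_rank 3 (form_4A1 : {mpoly R[i][4]}) 5 /\
  (* A1 A2 *)
  (forall rho : R[i], rho != 0 -> rho != 1 ->
     rho = (1 + sqrtC 3 * 'i) / 2 \/ rho = (1 - sqrtC 3 * 'i) / 2 ->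
     has_rank 3 (form_A1A2 rho) 6) /\
  (* 2A1 A2 *)
  has_rank 3 (form_2A1A2 : {mpoly R[i][4]}) 6 /\
  (* A1 2A2 *)
  has_rank 3 (form_A1_2A2 : {mpoly R[i][4]}) 6 /\
  (* A1 A3 *)
  has_rank 3 (form_A1A3 : {mpoly R[i][4]}) 6 /\
  (* 2A1 A3 *)
  has_rank 3 (form_2A1A3 : {mpoly R[i][4]}) 6 /\
  (* A1 A4 *)
  has_rank 3 (form_A1A4 : {mpoly R[i][4]}) 6 /\
  (* A1 A5 *)
  has_rank 3 (form_A1A5 : {mpoly R[i][4]}) 6 /\
  (* A2 *)
  (forall rho1 rho2 : R[i],
     rho1 != 2 -> rho1 != -2 -> rho2 != 2 -> rho2 != -2 ->
     rho1 = 0 -> rho2 = 0 -> has_rank 3 (form_A2 rho1 rho2) 6) /\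
  (* 2A2 *)
  (forall rho : R[i], rho != 2 -> rho != -2 ->
     rho ^+ 2 != 3 -> has_rank 3 (form_2A2 rho) 6) /\
  (* 3A2 *)
  has_rank 3 (form_3A2 : {mpoly R[i][4]}) 5 /\
  (* A3 *)
  (forall rho : R[i], rho != 0 -> has_rank 3 (form_A3 rho) 6) /\
  (* A4 *)
  has_rank 3 (form_A4 : {mpoly R[i][4]}) 6 /\
  (* A5 *)
  has_rank 3 (form_A5 : {mpoly R[i][4]}) 6 /\
  (* D4 I *)
  has_rank 3 (form_D4_I : {mpoly R[i][4]}) 6 /\
  (* D4 II *)
  has_rank 3 (form_D4_II : {mpoly R[i][4]}) 5 /\
  (* D5 *)
  has_rank 3 (form_D5 : {mpoly R[i][4]}) 6 /\
  (* E6 *)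
  has_rank 3 (form_E6 : {mpoly R[i][4]}) 6 /\
  (* E6 tilde *)
  (forall rho : R[i], rho ^+ 3 != 1 ->
     (rho ^+ 3 = 0 \/ rho ^+ 3 = -8 -> has_rank 3 (form_E6_tilde rho) 3) /\
     (~ (rho ^+ 3 = 0 \/ rho ^+ 3 = -8) -> has_rank 3 (form_E6_tilde rho) 4)).
Proof.
split; first by split; [exact: form_A1_generic | exact: form_A1_example].
split; first by split; [exact: form_2A1_generic | exact: form_2A1_example].
split; first by move=> rho rho0 _; apply: form_3A1_rank.
split; first exact: form_4A1_rank.
split.
  by move=> rho rho0 _ /equianharmonic_parameter; apply: form_A1A2_rank.
split; first exact: form_2A1A2_rank.
split; first exact: form_A1_2A2_rank.
split; first exact: form_A1A3_rank.
split; first exact: form_2A1A3_rank.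
split; first exact: form_A1A4_rank.
split; first exact: form_A1A5_rank.
split; first by move=> _ _ _ _ _ _ -> ->; apply: form_A2_rank.
split; first by move=> rho; apply: form_2A2_rank.
split; first exact: form_3A2_rank.
split; first by move=> rho _; apply: form_A3_rank.
split; first exact: form_A4_rank.
split; first exact: form_A5_rank.
split; first exact: form_D4_I_rank.
split; first exact: form_D4_II_rank.
split; first exact: form_D5_rank.
split; first exact: form_E6_rank.
move=> rho rho3; split=> rhoS.
  by split; [exact: form_E6_tilde_cubes3 | exact: form_E6_tilde_ge3].
split=> [|s f_s]; first exact: form_E6_tilde_cubes4.
have := form_E6_tilde_ge3 f_s; rewrite leq_eqVlt => /orP[/eqP s3|//].
by case: rhoS; move: f_s; rewrite -s3; apply: form_E6_tilde_rank3.
Qed.
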